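(* The computation of all non-zero components of the Hessian matrix $\partial^2\mathcal H/\partial\mathbf Y\,\partial\mathbf Y^\top$ of the three-dimensional hypervolume indicator takes computational time $\Theta(n\log n)$. That is, consider the problem whose input is a reference point $\mathbf r\in\mathbb R^3$ and $n$ mutually non-dominated points $\mathbf y^{(1)},\dots,\mathbf y^{(n)}\in\mathbb R^3$ in general position, all dominating $\mathbf r$, and whose output is the list of all non-zero components of the Hessian matrix of $\mathcal H$ at $\mathbf Y$ (with their index pairs). Then the worst-case time complexity of this problem is $\Theta(n\log n)$.
   Context: Minimization is considered. For $\mathbf p,\mathbf q\in\mathbb R^3$, $\mathbf p\prec\mathbf q$ (''$\mathbf p$ dominates $\mathbf q$'') means $p_i<q_i$ for all $i$. Points are in general position if no two of them share a value in the same coordinate. The hypervolume indicator of a finite $Y\subset\mathbb R^3$ with reference point $\mathbf r$ is $\operatorname{HV}(Y)=\lambda_3(\{\mathbf p: \exists \mathbf y\in Y,\ \mathbf y\prec\mathbf p\prec\mathbf r\})$, with $\lambda_3$ the Lebesgue measure. The function $\mathcal H:\mathbb R^{3n}\to\mathbb R_{\ge0}$ sends the concatenation $\mathbf Y=(y^{(1)}_1,y^{(1)}_2,y^{(1)}_3,\dots,y^{(n)}_1,y^{(n)}_2,y^{(n)}_3)^\top$ to $\operatorname{HV}(\{\mathbf y^{(1)},\dots,\mathbf y^{(n)}\})$. Its Hessian is the $3n\times3n$ matrix of second partial derivatives $\partial^2\mathcal H/\partial y^{(i)}_p\partial y^{(j)}_q$. Time is measured as the number of unit-cost arithmetic operations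 and comparisons on real numbers (standard model of computational geometry). *)

(* Defs.v *)
From HB Require Import structures.
From mathcomp Require Import all_boot all_order all_algebra.
From mathcomp Require Import all_classical all_reals all_analysis.
Set Implicit Arguments.
Unset Strict Implicit.
Unset Printing Implicit Defensive.
Import Order.TTheory GRing.Theory Num.Theory.
Import numFieldNormedType.Exports.
Local Open Scope classical_set_scope.
Local Open Scope ring_scope.

(** * The hypervolume indicator in dimension three and its Hessian *)

Definition dominates (R : realType) (p q : 'rV[R]_3) : Prop :=
  forall i : 'I_3, p 0 i < q 0 i.

(* The library has the Lebesgue measure on R and binary products of measures
   only, hence the identification of R * R * R with 'rV_3. *)
Definition vec3 (R : realType) (p : R * R * R) : 'rV[R]_3 :=
  \row_(i < 3) nth 0 [:: p.1.1; p.1.2; p.2] i.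

Definition lebesgue3 (R : realType) (A : set 'rV[R]_3) : \bar R :=
  (((@lebesgue_measure R) \x (@lebesgue_measure R)) \x (@lebesgue_measure R))%E
    (@vec3 R @^-1` A).

(* [fine] discards nothing for finite [Y]: the measured set is then bounded. *)
Definition HV (R : realType) (r : 'rV[R]_3) (Y : set 'rV[R]_3) : R :=
  fine (lebesgue3 [set p | exists2 y, Y y & dominates y p /\ dominates p r]).

Lemma coord_proof (n : nat) (i : 'I_n) (p : 'I_3) : (3 * i + p < 3 * n)%N.
Proof.
apply: (@leq_trans (3 * i.+1)); last by rewrite leq_mul2l ltn_ord.
by rewrite mulnS addnC ltn_add2r ltn_ord.
Qed.

(* Position, in the concatenated vector, of coordinate [p] of point [i]. *)
Definition coord (n : nat) (i : 'I_n) (p : 'I_3) : 'I_(3 * n) :=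
  Ordinal (coord_proof i p).

Definition ith_point (R : realType) (n : nat) (Y : 'rV[R]_(3 * n)) (i : 'I_n) :
    'rV[R]_3 :=
  \row_p Y 0 (coord i p).

Definition calH (R : realType) (n : nat) (r : 'rV[R]_3) (Y : 'rV[R]_(3 * n)) :
    R :=
  HV r (range (ith_point Y)).

(* Entry (a, b) is the partial derivative along the a-th basis vector of the
   partial derivative along the b-th one. *)
Definition hessian (R : realType) (m : nat) (f : 'rV[R]_m -> R)
    (Y : 'rV[R]_m) : 'M[R]_m :=
  \matrix_(a, b) 'D_(delta_mx 0 a) (fun Z => 'D_(delta_mx 0 b) f Z) Y.

(** * The real RAM *)

(* A real RAM in structured form.  The machine has an unbounded memory of
   natural numbers and an unbounded memory of real numbers, each organised as
   arrays: [imem s a k] is cell [k] of the integer array named [a].  A program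
   mentions finitely many array names, and cell indices are computed, so
   indirect addressing is available.  Reals influence the integer memory and
   the control flow only through comparisons: there is no conversion from reals
   to integers, in particular no floor function.  Integer arithmetic is limited
   to addition, truncated subtraction and halving, so that the integers produced
   in [t] steps have O(t) more bits than the initial ones. *)
Record state (R : realType) := State {
  imem : nat -> nat -> nat;
  rmem : nat -> nat -> R
}.

Inductive iexp : Type :=
| IConst of nat
| ILoad of nat & iexp
| IAdd of iexp & iexp
| ISub of iexp & iexp
| IHalf of iexp.

Inductive rop : Type := Radd | Rsub | Rmul | Rdiv.

Inductive rexp : Type :=
| ROfInt of iexp
| RLoad of nat & iexp
| ROp of rop & rexp & rexp.

Inductive bexp : Type :=
| BLtI of iexp & iexp
| BLtR of rexp & rexp
| BNot of bexp
| BAnd of bexp & bexp.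

Inductive cmd : Type :=
| Skip
| IStore of nat & iexp & iexp
| RStore of nat & iexp & rexp
| Seq of cmd & cmd
| If of bexp & cmd & cmd
| While of bexp & cmd.

Definition update (T : Type) (mem : nat -> nat -> T) (a k : nat) (v : T) :
    nat -> nat -> T :=
  fun a' k' => if (a' == a) && (k' == k) then v else mem a' k'.

Fixpoint ieval (R : realType) (s : state R) (e : iexp) : nat :=
  match e with
  | IConst c => c
  | ILoad a k => imem s a (ieval s k)
  | IAdd e1 e2 => (ieval s e1 + ieval s e2)%N
  | ISub e1 e2 => (ieval s e1 - ieval s e2)%N
  | IHalf e1 => (ieval s e1)./2
  end.

(* Division by zero returns 0, as everywhere in the library. *)
Definition rop_eval (R : realType) (o : rop) (x y : R) : R :=
  match o with
  | Radd => x + y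
  | Rsub => x - y
  | Rmul => x * y
  | Rdiv => x / y
  end.

Fixpoint reval (R : realType) (s : state R) (e : rexp) : R :=
  match e with
  | ROfInt e1 => (ieval s e1)%:R
  | RLoad a k => rmem s a (ieval s k)
  | ROp o e1 e2 => rop_eval o (reval s e1) (reval s e2)
  end.

Fixpoint beval (R : realType) (s : state R) (e : bexp) : bool :=
  match e with
  | BLtI e1 e2 => (ieval s e1 < ieval s e2)%N
  | BLtR e1 e2 => reval s e1 < reval s e2
  | BNot e1 => ~~ beval s e1
  | BAnd e1 e2 => beval s e1 && beval s e2
  end.

(* Arithmetic operations and comparisons on reals have unit cost.  All other
   operations (memory accesses, integer and boolean operations, conversions) are
   free under [RealOps] and have unit cost under [AllOps]. *)
Inductive cost_measure : Type := RealOps | AllOps.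

Definition bookkeeping (m : cost_measure) : nat :=
  match m with RealOps => 0 | AllOps => 1 end.

Fixpoint icost (m : cost_measure) (e : iexp) : nat :=
  match e with
  | IConst _ => bookkeeping m
  | ILoad _ k => bookkeeping m + icost m k
  | IAdd e1 e2 => bookkeeping m + icost m e1 + icost m e2
  | ISub e1 e2 => bookkeeping m + icost m e1 + icost m e2
  | IHalf e1 => bookkeeping m + icost m e1
  end%N.

Fixpoint rcost (m : cost_measure) (e : rexp) : nat :=
  match e with
  | ROfInt e1 => bookkeeping m + icost m e1
  | RLoad _ k => bookkeeping m + icost m k
  | ROp _ e1 e2 => 1 + rcost m e1 + rcost m e2
  end%N.

Fixpoint bcost (m : cost_measure) (e : bexp) : nat :=
  match e with
  | BLtI e1 e2 => bookkeeping m + icost m e1 + icost m e2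
  | BLtR e1 e2 => 1 + rcost m e1 + rcost m e2
  | BNot e1 => bookkeeping m + bcost m e1
  | BAnd e1 e2 => bookkeeping m + bcost m e1 + bcost m e2
  end%N.

(* [exec m c s s' t]: started in [s], [c] halts in [s'] at total cost [t]. *)
Inductive exec (R : realType) (m : cost_measure) :
    cmd -> state R -> state R -> nat -> Prop :=
| ESkip s : exec m Skip s s 0%N
| EIStore s a k e :
    exec m (IStore a k e) s
      (State (update (imem s) a (ieval s k) (ieval s e)) (rmem s))
      (bookkeeping m + icost m k + icost m e)%N
| ERStore s a k e :
    exec m (RStore a k e) s
      (State (imem s) (update (rmem s) a (ieval s k) (reval s e)))
      (bookkeeping m + icost m k + rcost m e)%N
| ESeq c1 c2 s1 s2 s3 t1 t2 :
    exec m c1 s1 s2 t1 -> exec m c2 s2 s3 t2 ->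
    exec m (Seq c1 c2) s1 s3 (t1 + t2)%N
| EIf b c1 c2 s s' t :
    exec m (if beval s b then c1 else c2) s s' t ->
    exec m (If b c1 c2) s s' (bcost m b + t)%N
| EWhileFalse b c s :
    ~~ beval s b -> exec m (While b c) s s (bcost m b)
| EWhileTrue b c s1 s2 s3 t1 t2 :
    beval s1 b -> exec m c s1 s2 t1 -> exec m (While b c) s2 s3 t2 ->
    exec m (While b c) s1 s3 (bcost m b + t1 + t2)%N.

(** * Worst-case complexity of a problem *)

Record problem (R : realType) := Problem {
  instance : nat -> Type;
  valid : forall n, instance n -> Prop;
  encode : forall n, instance n -> state R;
  answer : forall n, instance n -> state R -> Prop
}.

Definition solves (R : realType) (m : cost_measure) (P : cmd) (pb : problem R) :
    Prop :=
  forall (n : nat) (x : instance pb n), valid x ->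
    exists (s : state R) (t : nat), exec m P (encode x) s t /\ answer x s.

Definition running_time (R : realType) (m : cost_measure) (P : cmd)
    (pb : problem R) (n : nat) (x : instance pb n) (t : nat) : Prop :=
  exists s : state R, exec m P (encode x) s t.

Definition worst_time_O (R : realType) (m : cost_measure) (P : cmd)
    (pb : problem R) (f : nat -> R) : Prop :=
  exists (C : R) (N : nat), 0 < C /\
    forall n, (N <= n)%N -> forall x : instance pb n, valid x ->
      forall t, running_time m P x t -> t%:R <= C * f n.

Definition worst_time_Omega (R : realType) (m : cost_measure) (P : cmd)
    (pb : problem R) (f : nat -> R) : Prop :=
  exists (c : R) (N : nat), 0 < c /\
    forall n, (N <= n)%N -> exists x : instance pb n, valid x /\
      exists t, running_time m P x t /\ c * f n <= t%:R.

Definition complexity_Theta (R : realType) (m : cost_measure) (pb : problem R)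
    (f : nat -> R) : Prop :=
  (exists P : cmd, solves m P pb /\ worst_time_O m P pb f) /\
  (forall P : cmd, solves m P pb -> worst_time_Omega m P pb f).

(** * The problem of listing the non-zero entries of the Hessian *)

Record hv_instance (R : realType) (n : nat) := HVInstance {
  refpoint : 'rV[R]_3;
  points : 'rV[R]_(3 * n)
}.

Definition hv_valid (R : realType) (n : nat) (x : hv_instance R n) : Prop :=
  [/\ forall i, dominates (ith_point (points x) i) (refpoint x),
      forall i j, ~ dominates (ith_point (points x) i) (ith_point (points x) j)
    & forall i j p, i != j ->
        ith_point (points x) i 0 p != ith_point (points x) j 0 p].

Definition read_row (R : realType) (m : nat) (v : 'rV[R]_m) (k : nat) : R :=
  if insub k is Some i then v 0 i else 0.

(* Integer cell (0, 0) holds n, real array 0 the 3 n coordinates of the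
   concatenated vector, real array 1 the reference point; all else is 0. *)
Definition hv_encode (R : realType) (n : nat) (x : hv_instance R n) : state R :=
  State
    (fun a k => if (a == 0%N) && (k == 0%N) then n else 0%N)
    (fun a k => if a == 0%N then read_row (points x) k
                else if a == 1%N then read_row (refpoint x) k else 0).

(* Integer cell (3, 0) holds the length of the output list; the row indices,
   column indices and values are in integer arrays 1, 2 and real array 2. *)
Definition output (R : realType) (s : state R) : seq (nat * nat * R) :=
  [seq (imem s 1 k, imem s 2 k, rmem s 2 k) | k <- iota 0 (imem s 3 0)].

Definition hessian_answer (R : realType) (n : nat) (x : hv_instance R n)
    (s : state R) : Prop :=
  uniq (output s) /\
  forall (a b : nat) (v : R), (a, b, v) \in output s <->
    exists i j : 'I_(3 * n),
      [/\ a = i, b = j, v = hessian (calH (refpoint x)) (points x) i j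
        & v != 0].

Definition hessian_problem (R : realType) : problem R :=
  @Problem R (hv_instance R) (@hv_valid R) (@hv_encode R) (@hessian_answer R).

(* Main.v *)
Require Import Defs.
From mathcomp Require Import all_boot all_order all_algebra.
From mathcomp Require Import fingroup perm.
From mathcomp Require Import all_classical all_reals all_analysis.
From mathcomp Require Import measurable_realfun ring zify.
Import Order.TTheory GRing.Theory Num.Theory.
Import numFieldNormedType.Exports.
(* Imported again because [coord] also names the coordinates in a basis. *)
Import Defs.
Set Implicit Arguments.
Unset Strict Implicit.
Unset Printing Implicit Defensive.
Local Open Scope classical_set_scope.
Local Open Scope ring_scope.

(** The problem splits into a formula for the Hessian, an algorithm that reads
    all non-zero entries off that formula, and a counting argument.

    Formula.  The measured region is a union of boxes, so inclusion-exclusion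
    makes the hypervolume an alternating sum, over the non-empty sets S of
    points, of products of three factors, one per coordinate; the factor of
    coordinate c only involves the point of S that is largest in coordinate c.
    In general position these maximisers do not change near Y, hence the
    indicator is locally a polynomial of degree at most one in every variable
    and its second derivatives are alternating sums over the sets S with
    prescribed maximisers i in coordinate p and j in coordinate q
    ([hessian_sum]).  Toggling the lowest point, in the third coordinate c, of
    the points lying below i in p and below j in q cancels all but two terms
    ([alternating_max_gap]), and leaves the length of an edge of the region: it
    runs in direction c, starts at the height of the higher one of i and j, and
    ends at the height of the lowest point lying below i in p and below j in q
    ([hessian_formula]).

    Algorithm.  That formula leaves two kinds of non-zero entries.  The entries
    (i, p; i, q) are all non-zero.  An entry (i, p; j, q) with i different from
    j is non-zero exactly if one of the points, say the one that is higher in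
    the third coordinate c, is i, and j is the nearest point to i in coordinate
    q among those below i in p and c, or the same with the roles of (i, p) and
    (j, q) exchanged ([hessian_neighbour], [hessian_offdiagonal_nz]).  So there
    are at most 18 n non-zero entries, and they are known as soon as one can
    answer 9 n queries: which point minimises coordinate c among those below a
    in p and below b in q?  For fixed p, q, c all the queries are answered by
    one sweep along p that inserts the points into a tournament tree indexed by
    their rank in q ([sweep_spec]); ranks come from a tournament sort
    ([sort_spec]).  Every insertion and every query costs O(log n).

    Lower bound.  Reals influence the integer memory only through comparisons,
    so two inputs of the same size whose comparisons have the same outcomes
    lead to the same index pairs in the output.  A program that always halts
    within time t hence produces at most 2 ^ t lists of index pairs
    ([card_le_exp_time]).  Along a chain of n points the positions of the
    non-zero entries reveal which point follows which, hence the n! orders of a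
    chain need n! different lists ([chain_answer_inj]), and n! is at least
    n ^ (n / 2). *)

(** * Inclusion-exclusion for the hypervolume *)

(** Expand the product of the factors 1 - 1_(A i), which is the indicator of
    the complement of the union. *)
Lemma indic_inclusion_exclusion (R : realType) (T : Type) (I : finType)
    (A : I -> set T) (x : T) :
  \1_(\bigcup_i A i) x = \sum_(S : {set I} | S != finset.set0)
    (-1) ^+ #|S|.+1 * \1_(\bigcap_(i in [set` S]) A i) x :> R.
Proof.
have iff01 (B : set T) : (\1_B x : R) = (`[<B x>] : nat)%:R.
  by rewrite indicE; congr ((nat_of_bool _)%:R); apply/idP/asboolP; rewrite inE.
have capE (S : {set I}) : \1_(\bigcap_(i in [set` S]) A i) x =
    \prod_(i in S) (\1_(A i) x : R).
  rewrite iff01; case: asboolP => [h|h].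
    by rewrite big1 // => i iS; rewrite iff01 asboolT//; apply: h.
  have [i /andP[iS /asboolPn nAi]] : exists i, (i \in S) && ~~ `[<A i x>].
    apply/existsP; apply: contra_notT h; rewrite negb_exists => /forallP h i /= iS.
    by have := h i; rewrite iS /= negbK => /asboolP.
  by rewrite (bigD1 i) //= iff01 asboolF // mul0r.
have : \prod_i (- \1_(A i) x + 1) = \sum_(S : {set I})
    (-1) ^+ #|S| * \1_(\bigcap_(i in [set` S]) A i) x :> R.
  rewrite bigA_distr; apply: eq_big => [S|S _]; first by rewrite finset.inE.
  by rewrite capE -prodrN [RHS]big_mkcond.
rewrite [in X in X -> _](bigD1 finset.set0) //= cards0 expr0 mul1r.
rewrite [X in (_ = X + _) -> _](_ : _ = 1); last first.
  by rewrite iff01 asboolT // => i /=; rewrite finset.inE.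
move=> /esym/(canRL (addKr _)) h.
under eq_bigr do rewrite exprS mulN1r mulNr.
rewrite sumrN h opprD opprK iff01.
case: asboolP => [[i _ Aix]|h2].
  by rewrite (bigD1 i) //= iff01 asboolT //= addNr mul0r subr0.
rewrite big1 ?subrr // => i _; rewrite iff01 asboolF ?oppr0 ?add0r //.
by move=> Aix; apply: h2; exists i.
Qed.

Lemma measure_inclusion_exclusion d (T : measurableType d) (R : realType)
    (mu : {measure set T -> \bar R}) (I : finType) (A : I -> set T) :
  (forall i, measurable (A i)) -> (forall i, (mu (A i) < +oo)%E) ->
  fine (mu (\bigcup_i A i)) = \sum_(S : {set I} | S != finset.set0)
    (-1) ^+ #|S|.+1 * fine (mu (\bigcap_(i in [set` S]) A i)).
Proof.
move=> mA fA.
have mcap (S : {set I}) : measurable (\bigcap_(i in [set` S]) A i).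
  by apply: fin_bigcap_measurable => // ; exact: finite_finset.
have mcup : measurable (\bigcup_i A i).
  by apply: fin_bigcup_measurable => // ; exact: finite_finset.
have fcap (S : {set I}) : S != finset.set0 -> (mu (\bigcap_(i in [set` S]) A i) < +oo)%E.
  move=> /set0Pn[i iS]; apply: le_lt_trans (fA i); apply: le_measure; rewrite ?inE//.
  exact: bigcap_inf.
have icap (S : {set I}) : S != finset.set0 ->
   mu.-integrable setT (fun x => (\1_(\bigcap_(i in [set` S]) A i) x)%:E : \bar R).
  move=> S0; apply/integrableP; split; first exact/measurable_EFinP.
  under eq_integral do rewrite gee0_abs ?lee_fin//.
  by rewrite integral_indic // setIT fcap.
rewrite -[X in mu X]setIT -integral_indic //.
pose g (S : {set I}) : T -> \bar R := if S != finset.set0 then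
  (fun x => ((-1) ^+ #|S|.+1)%:E * (\1_(\bigcap_(i in [set` S]) A i) x)%:E)%E
  else cst 0%E.
have gi S : mu.-integrable setT (g S).
  rewrite /g; case: ifPn => S0; last exact: integrable0.
  by apply: integrableZl => //; exact: icap.
transitivity (fine (\int[mu]_x (\sum_(S : {set I}) g S x)%E)).
  congr fine; apply: eq_integral => x _.
  rewrite indic_inclusion_exclusion -sumEFin big_mkcond.
  by apply: eq_bigr => S _; rewrite /g; case: ifP.
rewrite (@integral_sum _ _ _ mu setT measurableT _ g gi) -sum_fine => [|S _]; last first.
  exact: integrable_fin_num.
rewrite [RHS]big_mkcond; apply: eq_bigr => S _; rewrite /g.
case: ifPn => S0; last by rewrite integral0.
rewrite integralZl //; last exact: icap.
by rewrite integral_indic // setIT fineM //= fin_num_abs gee0_abs ?fcap.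
Qed.

(** Boxes live in the nested product on which the measure is defined, not in
    the space of row vectors. *)
Definition box (R : realType) (p q : 'I_3 -> R) : set (R * R * R) :=
  (`]p ord0, q ord0[ `*` `]p (inord 1), q (inord 1)[) `*` `]p (inord 2), q (inord 2)[.

Lemma box_dominates (R : realType) (p q : 'rV[R]_3) (x : R * R * R) :
  box (p 0) (q 0) x <-> dominates p (vec3 x) /\ dominates (vec3 x) q.
Proof.
have e3 (P : 'I_3 -> Prop) : (forall i, P i) <-> [/\ P ord0, P (inord 1) & P (inord 2)].
  split=> [h|[h0 h1 h2]]; first by split.
  case=> -[|[|[|//]]] hi; [move: h0|move: h1|move: h2];
    by congr P; apply: val_inj; rewrite /= ?inordK.
rewrite /dominates !e3 /vec3 !mxE /box /= !inordK //= !in_itv /=.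
split=> [[[/andP[-> ->] /andP[-> ->]] /andP[-> ->]]//|].
by case=> -[-> -> ->] [-> -> ->].
Qed.

Lemma measure_box (R : realType) (p q : 'I_3 -> R) : (forall c, p c < q c) ->
  (((@lebesgue_measure R) \x (@lebesgue_measure R)) \x (@lebesgue_measure R))%E
    (box p q) = (\prod_c (q c - p c))%:E.
Proof.
move=> pq; have mi (a b : R) : measurable `]a, b[%classic by exact: measurable_itv.
pose LL : {measure set _ -> \bar R} := (@lebesgue_measure R \x @lebesgue_measure R)%E.
rewrite /box (@product_measure1E _ _ _ _ R LL lebesgue_measure _ _ (measurableX (mi _ _) (mi _
    _)) (mi _ _)).
rewrite [X in (X * _)%E](@product_measure1E _ _ _ _ R lebesgue_measure lebesgue_measure _ _ (mi _
    _) (mi _ _)).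
rewrite /= !lebesgue_measure_itv /= !lte_fin !pq -!EFinD -!EFinM.
rewrite !big_ord_recl big_ord0 mulr1 mulrA; congr EFin.
by do 2?congr (_ * _); congr (q _ - p _); apply: val_inj; rewrite /= inordK.
Qed.

Lemma measurable_box (R : realType) (p q : 'I_3 -> R) : measurable (box p q).
Proof.
by apply: measurableX; [apply: measurableX|]; exact: measurable_itv.
Qed.

(** The boxes of the points of a set S meet in the box whose lower corner is,
    coordinate by coordinate, the largest one over S.  The maximisers are a
    parameter of the lemma: near a configuration in general position the same
    choice serves all configurations. *)
Lemma calH_inclusion_exclusion (R : realType) (n : nat) (r : 'rV[R]_3)
    (Z : 'rV[R]_(3 * n)) (top : {set 'I_n} -> 'I_3 -> 'I_n) :
  (forall i c, Z 0 (coord i c) < r 0 c) ->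
  (forall (S : {set 'I_n}) c, S != finset.set0 -> top S c \in S) ->
  (forall (S : {set 'I_n}) c i, i \in S -> Z 0 (coord i c) <= Z 0 (coord (top S c) c)) ->
  calH r Z = \sum_(S : {set 'I_n} | S != finset.set0)
    (-1) ^+ #|S|.+1 * \prod_c (r 0 c - Z 0 (coord (top S c) c)).
Proof.
move=> Zr topS topmax.
pose B i := box (ith_point Z i 0) (r 0).
have Zr' i c : ith_point Z i 0 c < r 0 c by rewrite mxE.
rewrite /calH /HV /lebesgue3.
rewrite [X in fine (_ X)](_ : _ = \bigcup_i B i); last first.
  apply/seteqP; split=> x /=.
    by move=> [_ [i _ <-] h]; exists i => //; apply/box_dominates.
  by move=> [i _ /box_dominates h]; exists (ith_point Z i) => //; exists i.
rewrite measure_inclusion_exclusion; last first.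
- by move=> i; rewrite [X in (X < _)%E](measure_box (Zr' i)) ltry.
- by move=> i; exact: measurable_box.
apply: eq_bigr => S S0; congr (_ * _).
have -> : \bigcap_(i in [set` S]) B i = box (fun c => Z 0 (coord (top S c) c)) (r 0).
  apply/seteqP; split=> [x h|x h i /= iS].
    have h' c : B (top S c) x by apply: h; exact: topS.
    have {}h' : (forall c, dominates (ith_point Z (top S c)) (vec3 x)) /\ dominates (vec3 x) r.
      by split=> [c|]; [have /box_dominates[] := h' c|have /box_dominates[] := h' ord0].
    have := @box_dominates _ (\row_c Z 0 (coord (top S c) c)) r x.
    rewrite (_ : box _ _ = box (fun c => Z 0 (coord (top S c) c)) (r 0)); last first.
      by rewrite /box !mxE.
    case=> _; apply; split; last by case: h'.
    by move=> c; case: h' => /(_ c c) + _; rewrite !mxE.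
  apply/box_dominates.
  have := @box_dominates _ (\row_c Z 0 (coord (top S c) c)) r x.
  rewrite (_ : box _ _ = box (fun c => Z 0 (coord (top S c) c)) (r 0)); last first.
    by rewrite /box !mxE.
  case=> /(_ h) [h1 h2] _; split=> // c.
  have := h1 c; rewrite !mxE; apply: le_lt_trans.
  exact: topmax.
by rewrite [X in fine X](measure_box (fun c => Zr (top S c) c)).
Qed.

(** * The Hessian as an alternating sum *)

(** The difference quotients of such a function are constant, so no limit
    theorem is needed for the derivatives below. *)
Lemma derive_affine (R : realType) (V : normedModType R) (f : V -> R) (a v : V) (d : R) :
  (forall k : R, f (a + k *: v) = f a + k * d) -> 'D_v f a = d.
Proof.
move=> fE; apply: lim_near_cst => //.
near=> h; rewrite /= [_ + a]addrC fE addrC addKr.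
rewrite /GRing.scale /= mulKf //.
by near: h; exact: nbhs_dnbhs_neq.
Unshelve. all: by end_near. Qed.

Lemma coord_inj (n : nat) (i j : 'I_n) (p q : 'I_3) :
  (coord i p == coord j q) = (i == j) && (p == q).
Proof.
rewrite -!val_eqE /=; apply/eqP/andP => [e|[/eqP -> /eqP -> //]].
by move: (ltn_ord p) (ltn_ord q) => lp lq; split; apply/eqP; lia.
Qed.

Lemma coord_surj (n : nat) (a : 'I_(3 * n)) : exists i p, a = coord i p.
Proof.
have ha := ltn_ord a.
have hi : (a %/ 3 < n)%N by lia.
have hp : (a %% 3 < 3)%N by lia.
exists (Ordinal hi), (Ordinal hp); apply: val_inj => /=; lia.
Qed.

Lemma coord_shift (R : realType) (n : nat) (Z : 'rV[R]_(3 * n)) (k : R)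
    (i j : 'I_n) (p q : 'I_3) :
  (Z + k *: delta_mx 0 (coord j q)) 0 (coord i p) =
  Z 0 (coord i p) + k * ((i == j) && (p == q))%:R.
Proof. by rewrite !mxE eqxx coord_inj /=. Qed.

(** The shifted coordinate [p] occurs in one factor only, so the product is
    affine in the shift; [e] tells whether that factor involves the shifted
    point. *)
Lemma prod_shift (R : realType) (Q : pred 'I_3) (l : 'I_3 -> R) (k : R)
    (e : bool) (p : 'I_3) :
  \prod_(c | Q c) (l c - k * (e && (c == p))%:R) =
  \prod_(c | Q c) l c + k * ((e && Q p)%:R * - \prod_(c | Q c && (c != p)) l c).
Proof.
case: (boolP (e && Q p)) => [/andP[-> Qp]|neQ]; last first.
  rewrite !mul0r mulr0 addr0; apply: eq_bigr => c Qc.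
  case: eqP => [cp|_]; last by rewrite andbF mulr0 subr0.
  by move: neQ; rewrite -cp Qc !andbT => /negbTE ->; rewrite mulr0 subr0.
rewrite (bigD1 p) //= eqxx [in RHS](bigD1 p) //= mulr1 mul1r.
rewrite (eq_bigr l) => [|c /andP[_ /negbTE ->]]; last by rewrite mulr0 subr0.
ring.
Qed.

(** In general position the maximisers of every set of points are strict, hence
    the same for all configurations near [Y].  Each summand of the
    inclusion-exclusion formula is then affine in each variable: the three
    factors of a product involve variables of three different coordinates. *)
Lemma hessian_sum (R : realType) (n : nat) (r : 'rV[R]_3) (Y : 'rV[R]_(3 * n))
    (top : {set 'I_n} -> 'I_3 -> 'I_n) :
  (forall i c, Y 0 (coord i c) < r 0 c) ->
  (forall (S : {set 'I_n}) c, S != finset.set0 -> top S c \in S) ->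
  (forall (S : {set 'I_n}) c i, i \in S -> i != top S c ->
     Y 0 (coord i c) < Y 0 (coord (top S c) c)) ->
  forall i j p q, hessian (calH r) Y (coord i p) (coord j q) =
    \sum_(S : {set 'I_n} | [&& S != finset.set0, top S p == i & top S q == j])
      if p == q then 0 else
      (-1) ^+ #|S|.+1 *
        \prod_(c | (c != p) && (c != q)) (r 0 c - Y 0 (coord (top S c) c)).
Proof.
move=> Yr topS topmax i j p q.
pose f (Z : 'rV[R]_(3 * n)) : R := \sum_(S : {set 'I_n} | S != finset.set0)
    (-1) ^+ #|S|.+1 * \prod_c (r 0 c - Z 0 (coord (top S c) c)).
pose g (Z : 'rV[R]_(3 * n)) : R := \sum_(S : {set 'I_n} | S != finset.set0)
    (-1) ^+ #|S|.+1 * ((top S q == j)%:R * - \prod_(c | c != q)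
    (r 0 c - Z 0 (coord (top S c) c))).
have factorE (S : {set 'I_n}) c (Z : 'rV[R]_(3 * n)) (k : R) i' p' : r 0 c -
    (Z + k *: delta_mx 0 (coord i' p') : 'rV[R]_(3 * n)) 0 (coord (top S c) c) =
    r 0 c - Z 0 (coord (top S c) c) - k * ((top S p' == i') && (c == p'))%:R.
  rewrite coord_shift opprD addrA; congr (_ - _ * (_ : bool)%:R).
  by have [->|] := eqVneq c p'; rewrite ?andbT ?andbF.
have fg Z : 'D_(delta_mx 0 (coord j q)) f Z = g Z.
  apply: derive_affine => k; rewrite /f /g mulr_sumr -big_split.
  apply: eq_bigr => S _ /=.
  under eq_bigr do rewrite factorE.
  rewrite (prod_shift xpredT) andbT mulrDr; congr (_ + _).
  by rewrite mulrCA.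
have gY : 'D_(delta_mx 0 (coord i p)) g Y =
    \sum_(S : {set 'I_n} | [&& S != finset.set0, top S p == i & top S q == j])
      if p == q then 0 else (-1) ^+ #|S|.+1 *
        \prod_(c | (c != p) && (c != q)) (r 0 c - Y 0 (coord (top S c) c)).
  apply: derive_affine => k; rewrite /g [X in _ = _ + k * X]big_mkcondr mulr_sumr -big_split.
  apply: eq_bigr => S _ /=.
  under eq_bigr do rewrite factorE.
  rewrite (prod_shift (fun c => c != q)).
  have -> : \prod_(c | (c != q) && (c != p)) (r 0 c - Y 0 (coord (top S c) c)) =
      \prod_(c | (c != p) && (c != q)) (r 0 c - Y 0 (coord (top S c) c)).
    by apply: eq_bigl => c; rewrite andbC.
  case: (eqVneq p q) => [->|pq]; first by rewrite if_same andbF mul0r !mulr0 !addr0.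
  case: (top S q == j); last by rewrite andbF !mul0r !mulr0 addr0.
  case: (top S p == i) => /=; ring.
rewrite mxE -gY; apply: near_eq_derive.
have near_f : \forall Z \near Y, calH r Z = f Z.
  have near_r : \forall Z \near Y, forall ic : 'I_n * 'I_3,
      (Z : 'rV[R]_(3 * n)) 0 (coord ic.1 ic.2) < r 0 ic.2.
    apply: (@filter_forall _ ('I_n * 'I_3)%type (fun ic (Z : 'rV[R]_(3 * n)) =>
      Z 0 (coord ic.1 ic.2) < r 0 ic.2) (nbhs Y)) => -[i' c] /=.
    exact: (cvgr_lt _ (@coord_continuous _ _ _ 0 (coord i' c) Y) _ (Yr i' c)).
  have near_top : \forall Z \near Y, forall Sci : {set 'I_n} * 'I_3 * 'I_n,
      Sci.2 \in Sci.1.1 ->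
      (Z : 'rV[R]_(3 * n)) 0 (coord Sci.2 Sci.1.2) <= Z 0 (coord (top Sci.1.1 Sci.1.2) Sci.1.2).
    apply: (@filter_forall _ ({set 'I_n} * 'I_3 * 'I_n)%type (fun Sci (Z : 'rV[R]_(3 * n)) =>
      Sci.2 \in Sci.1.1 -> Z 0 (coord Sci.2 Sci.1.2) <= Z 0 (coord (top Sci.1.1 Sci.1.2) Sci.1.2))
      (nbhs Y)) => -[[S c] i'] /=.
    case: (boolP (i' \in S)) => [iS|_]; last by apply: nearW.
    have [->|it] := eqVneq i' (top S c); first by apply: nearW.
    have := topmax _ _ _ iS it; rewrite -subr_lt0 => lt0.
    have : \forall Z \near Y, (Z : 'rV[R]_(3 * n)) 0 (coord i' c) - Z 0 (coord (top S c) c) < 0.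
      have cvgZ : ((Z : 'rV[R]_(3 * n)) 0 (coord i' c) - Z 0 (coord (top S c) c))
          @[Z --> Y] --> Y 0 (coord i' c) - Y 0 (coord (top S c) c).
        apply: (@cvgB _ _ _ (nbhs Y)); first exact: (@coord_continuous _ _ _ 0 (coord i' c) Y).
        exact: (@coord_continuous _ _ _ 0 (coord (top S c) c) Y).
      exact: (cvgr_lt _ cvgZ _ lt0).
    by apply: filterS => Z; rewrite subr_lt0 => /ltW.
  apply: filterS2 near_r near_top => Z Zr Ztop; apply: calH_inclusion_exclusion => //.
  - by move=> i' c; exact: (Zr (i', c)).
  - by move=> S c i'; exact: (Ztop (S, c, i')).
near=> Z; rewrite -fg; apply: near_eq_derive.
by near: Z; apply: (near_join near_f).
Unshelve. all: by end_near. Qed.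

(** * Cancellation in the alternating sum *)

Section AlternatingMax.
Variables (R : realType) (I : finType) (y : I -> R) (rho b : R).
Hypothesis b_lt : b < rho.
Hypothesis y_lt : forall i, y i < rho.

(** Adding or removing the point [k0] of [W] at which [y] is least changes the
    sign of a summand and keeps the maximum, as soon as [T] contains another
    point of [W].  Only the summands of the empty set and of [k0] survive. *)
Lemma alternating_max_gap (W : {set I}) :
  \sum_(T : {set I} | T \subset W)
    (-1) ^+ #|T| * (rho - \big[Num.max/b]_(k in T) y k) =
  Num.max 0 (\big[Num.min/rho]_(k in W) y k - b).
Proof.
have [->|/set0Pn[k0' k0'W]] := eqVneq W finset.set0.
  rewrite (big_pred1 finset.set0) => [|T]; last by rewrite finset.subset0.
  rewrite cards0 expr0 mul1r !finset.big_set0.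
  by apply/esym/max_idPr; rewrite subr_ge0 ltW.
case: (Order.TotalTheory.arg_minP y k0'W) => k0 /= k0W k0min {k0' k0'W}.
have {}k0W : k0 \in W := k0W.
have maxU1 (T : {set I}) : k0 \notin T ->
    \big[Num.max/b]_(k in k0 |: T) y k = Num.max (y k0) (\big[Num.max/b]_(k in T) y k).
  move=> k0T; rewrite (bigmaxD1 k0) ?finset.setU11 //; congr Num.max; apply: eq_bigl => k.
  by rewrite finset.in_setU1; have [->|] := eqVneq k k0; rewrite ?(negbTE k0T) //= andbT.
pose F (T : {set I}) := (-1) ^+ #|T| * (rho - \big[Num.max/b]_(k in T) y k).
(* Match every set that contains [k0] with the same set without [k0]. *)
rewrite (bigID (fun T : {set I} => k0 \in T)) /=.
rewrite (reindex_onto (fun T => k0 |: T) (fun T => T :\ k0)) /=; last first.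
  by move=> T /andP[_ k0T]; rewrite finset.setD1K.
rewrite (eq_bigl (fun T : {set I} => (T \subset W) && (k0 \notin T))); last first.
  move=> T; rewrite finset.subUset finset.sub1set k0W finset.setU11 /= andbT; congr (_ && _).
  apply/eqP/idP => [<-|k0T]; first by rewrite finset.inE finset.in_set1 eqxx.
  by rewrite setU1K.
rewrite -big_split /= (bigD1 finset.set0) /=; last by rewrite finset.sub0set finset.in_set0.
rewrite [X in _ + X]big1 => [|T /andP[/andP[TW k0T] T0]]; last first.
  rewrite cardsU1 k0T exprS mulN1r mulNr [X in - X](_ : _ = F T) ?addNr //.
  rewrite /F maxU1 //; congr (_ * (_ - _)); apply/max_idPr.
  have [k kT] := set0Pn _ T0.
  rewrite (bigmaxD1 k) //= le_max k0min //.
  exact: (fintype.subsetP TW).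
rewrite addr0 maxU1 ?finset.in_set0 // cardsU1 finset.in_set0 cards0 expr1 expr0.
rewrite !finset.big_set0.
have -> : \big[Num.min/rho]_(k in W) y k = y k0.
  apply/eqP; rewrite eq_le bigmin_le_cond //= le_bigmin // ltW //.
rewrite -[0](subrr b) -addr_maxl [Num.max b _]maxC; ring.
Qed.

End AlternatingMax.

Section HessianFormula.
Variables (R : realType) (n : nat) (r : 'rV[R]_3) (Y : 'rV[R]_(3 * n)).
Hypothesis Yr : forall i c, Y 0 (coord i c) < r 0 c.
Hypothesis Y_inj : forall i j c, i != j -> Y 0 (coord i c) != Y 0 (coord j c).

(** The edge of the dominated region in direction [s] at height [i] in [p] and
    [j] in [q] is cut off by the points that lie below both heights. *)
Definition corner_set (i j : 'I_n) (p q : 'I_3) : {set 'I_n} :=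
  [set k : 'I_n | (Y 0 (coord k p) < Y 0 (coord i p)) &&
         (Y 0 (coord k q) < Y 0 (coord j q))]%SET.

Definition corner_end (i j : 'I_n) (p q s : 'I_3) : R :=
  \big[Num.min/r 0 s]_(k in corner_set i j p q) Y 0 (coord k s).

Lemma top_exists (i0 : 'I_n) : exists top : {set 'I_n} -> 'I_3 -> 'I_n,
  (forall (S : {set 'I_n}) c, S != finset.set0 -> top S c \in S) /\
  (forall (S : {set 'I_n}) c i, i \in S -> i != top S c ->
     Y 0 (coord i c) < Y 0 (coord (top S c) c)).
Proof.
exists (fun (S : {set 'I_n}) c => [arg max_(k > odflt i0 [pick k in S] in S) Y 0 (coord k c)]%O).
have pickS (S : {set 'I_n}) i : i \in S -> odflt i0 [pick k in S] \in S.
  by move=> iS; case: pickP => //= /(_ i); rewrite iS.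
split=> [S c /set0Pn[i iS]|S c i iS].
  by case: Order.TotalTheory.arg_maxP => //; exact: pickS iS.
case: Order.TotalTheory.arg_maxP => [|k kS kmax ik]; first exact: pickS iS.
by rewrite lt_neqAle Y_inj //=; exact: kmax.
Qed.

Lemma hessian_same_coordinate (i j : 'I_n) (p : 'I_3) :
  hessian (calH r) Y (coord i p) (coord j p) = 0.
Proof.
have [top [topS topmax]] := top_exists i.
by rewrite (hessian_sum Yr topS topmax) eqxx big1.
Qed.

(** A set [S] has strict maximisers [i] in [p] and [j] in [q] exactly if it
    consists of [i], [j] and a part of the corner set, and if each of [i] and
    [j] is below the other one in the other coordinate.  The sum over these
    sets is therefore an alternating sum over the subsets of the corner set. *)
Lemma hessian_formula (i j : 'I_n) (p q s : 'I_3) :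
  p != q -> s != p -> s != q ->
  hessian (calH r) Y (coord i p) (coord j q) =
  if i == j then Num.max 0 (corner_end i i p q s - Y 0 (coord i s))
  else if (Y 0 (coord j p) < Y 0 (coord i p)) && (Y 0 (coord i q) < Y 0 (coord j q))
  then - Num.max 0 (corner_end i j p q s - Num.max (Y 0 (coord i s)) (Y 0 (coord j s)))
  else 0.
Proof.
move=> pq sp sq; have [top [topS topmax]] := top_exists i.
rewrite (hessian_sum Yr topS topmax) (negbTE pq).
pose y k c := Y 0 (coord k c).
pose B : {set 'I_n} := [set i; j]%SET.
pose ok := (i == j) || (y j p < y i p) && (y i q < y j q).
have topE (S : {set 'I_n}) c k : k \in S ->
    (forall l, l \in S -> l != k -> y l c < y k c) -> top S c = k.
  move=> kS kmax; apply/eqP; apply/negPn/negP => tk.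
  have S0 : S != finset.set0 by apply/set0Pn; exists k.
  have := topmax S c k kS; rewrite eq_sym => /(_ tk).
  by rewrite ltNge ltW // kmax // topS.
(* The sets with the prescribed maximisers, in terms of the corner set. *)
have selE (S : {set 'I_n}) :
    [&& S != finset.set0, top S p == i & top S q == j] =
    [&& ok, B \subset S & S :\: B \subset corner_set i j p q].
  apply/idP/idP.
    case/and3P=> S0 /eqP tp /eqP tq.
    have iS : i \in S by rewrite -tp topS.
    have jS : j \in S by rewrite -tq topS.
    apply/and3P; split.
    - rewrite /ok; have [//|ij /=] := eqVneq i j.
      have := topmax S p j jS; rewrite tp eq_sym => /(_ ij); rewrite -/(y _ _) => ->.
      by have := topmax S q i iS; rewrite tq => /(_ ij).
    - by apply/fintype.subsetP => k; rewrite !finset.inE => /orP[]/eqP ->.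
    - apply/fintype.subsetP => k; rewrite !finset.inE negb_or => /andP[/andP[ki kj] kS].
      have := topmax S p k kS; rewrite tp => /(_ ki) ->.
      by have := topmax S q k kS; rewrite tq => /(_ kj) ->.
  case/and3P=> okij /fintype.subsetP BS /fintype.subsetP SW.
  have iS : i \in S by apply: BS; rewrite !finset.inE eqxx.
  have jS : j \in S by apply: BS; rewrite !finset.inE eqxx orbT.
  have S0 : S != finset.set0 by apply/set0Pn; exists i.
  rewrite S0 /=; apply/andP; split; apply/eqP; apply: topE => // l lS.
    move=> li; have [lj|lj] := eqVneq l j.
      by move: okij; rewrite /ok -lj eq_sym (negbTE li) => /andP[].
    by have := SW l; rewrite !finset.inE (negbTE li) (negbTE lj) lS => /(_ isT)/andP[].
  move=> lj; have [li|li] := eqVneq l i.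
    by move: okij; rewrite /ok -li (negbTE lj) => /andP[].
  by have := SW l; rewrite !finset.inE (negbTE li) (negbTE lj) lS => /(_ isT)/andP[].
rewrite (eq_bigl _ _ selE).
have -> : (if i == j then Num.max 0 (corner_end i i p q s - Y 0 (coord i s))
  else if (Y 0 (coord j p) < Y 0 (coord i p)) && (Y 0 (coord i q) < Y 0 (coord j q))
  then - Num.max 0 (corner_end i j p q s - Num.max (Y 0 (coord i s)) (Y 0 (coord j s)))
  else 0) = if ok then (-1) ^+ #|B|.+1 *
    Num.max 0 (corner_end i j p q s - Num.max (y i s) (y j s)) else 0.
  rewrite /ok /B; have [<-|ij] := eqVneq i j.
    by rewrite finset.setUid cards1 maxxx expr2 mulrNN !mul1r.
  by rewrite /= cards2 ij exprSr expr2 mulrNN !mul1r mulN1r.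
case: ifP => okij; last by rewrite big_pred0.
rewrite /=.
have WB k : k \in corner_set i j p q -> k \notin B.
  rewrite !finset.inE => /andP[kp kq].
  by apply/negP => /orP[]/eqP e; [move: kp|move: kq]; rewrite e ltxx.
rewrite (reindex_onto (fun T => B :|: T) (fun S => S :\: B)) /=; last first.
  move=> S /andP[/fintype.subsetP BS _]; apply/finset.setP => k.
  by rewrite finset.in_setU finset.in_setD; have [/BS ->|] := boolP (k \in B).
rewrite (eq_bigl (fun T : {set 'I_n} => T \subset corner_set i j p q)); last first.
  move=> T; rewrite finset.subsetUl /= finset.setDUl finset.setDv finset.set0U.
  apply/andP/idP => [[TW /eqP <- //]|TW].
  have -> : T :\: B = T.
    apply/finset.setDidPl; rewrite finset.disjoints_subset; apply/fintype.subsetP => k kT.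
    by rewrite finset.inE WB // (fintype.subsetP TW).
  by rewrite TW.
rewrite -(@alternating_max_gap _ _ (fun k => y k s) (r 0 s) (Num.max (y i s) (y j s)));
    last 2 first.
- by rewrite gt_max !Yr.
- by move=> k; exact: Yr.
rewrite mulr_sumr; apply: eq_bigr => T TW.
have BT0 : B :&: T = finset.set0.
  apply/finset.setP => k; rewrite finset.in_setI finset.in_set0.
  apply/negP => /andP[kB /(fintype.subsetP TW)/WB]; by rewrite kB.
rewrite (big_pred1 s) => [|c]; last first.
  case: c p q s pq sp sq {TW BT0 WB okij ok B selE topE} => [c hc] [p hp] [q hq] [s hs].
  rewrite [pred1 _ _]/= -!val_eqE /=; lia.
rewrite mulrA -exprD; congr (_ * (_ - _)).
  by congr (_ ^+ _); rewrite cardsU BT0 cards0 subn0 addSn.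
have S0 : B :|: T != finset.set0.
  by apply/set0Pn; exists i; rewrite !finset.inE eqxx.
have tS := topS _ s S0.
have tle k : k \in B :|: T -> y k s <= y (top (B :|: T) s) s.
  move=> kS; have [->//|kt] := eqVneq k (top (B :|: T) s).
  by apply/ltW/topmax.
apply/eqP; rewrite eq_le; apply/andP; split; last first.
  apply: bigmax_le => [|k kT]; last by rewrite tle // finset.inE kT orbT.
  by rewrite ge_max !tle // !finset.inE eqxx ?orbT.
move: tS; rewrite finset.in_setU !finset.inE => /orP[tB|tT].
  apply: (@le_trans _ _ (Num.max (y i s) (y j s))); last exact: bigmax_ge_id.
  by rewrite le_max; case/orP: tB => /eqP ->; rewrite lexx ?orbT.
exact: (le_bigmax_cond _ (fun k => y k s) tT).
Qed.

End HessianFormula.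

(** * Executions and time budgets *)

Section Machine.
Variable R : realType.
Implicit Types (s : state R) (c : cmd).

Lemma exec_deterministic m c s s1 s2 t1 t2 :
  exec m c s s1 t1 -> exec m c s s2 t2 -> s1 = s2 /\ t1 = t2.
Proof.
move=> e1; elim: e1 s2 t2 => {c s s1 t1}.
- by move=> s s2 t2 e; inversion e.
- by move=> s a k e s2 t2 e2; inversion e2.
- by move=> s a k e s2 t2 e2; inversion e2.
- move=> c1 c2 s1 s2 s3 t1 t2 _ ih1 _ ih2 s4 t4 e; inversion e; subst.
  have [? ?] := ih1 _ _ ltac:(eassumption); subst.
  by have [? ?] := ih2 _ _ ltac:(eassumption); subst.
- move=> b c1 c2 s s' t _ ih s2 t2 e; inversion e; subst.
  by have [? ?] := ih _ _ ltac:(eassumption); subst.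
- move=> b c s nb s2 t2 e; inversion e; subst => //.
  by match goal with h : is_true (beval _ _) |- _ => rewrite h in nb end.
- move=> b c s1 s2 s3 t1 t2 sb _ ih1 _ ih2 s4 t4 e; inversion e; subst.
    match goal with h1 : is_true (beval _ _), h2 : is_true (~~ beval _ _) |- _ =>
        by rewrite h1 in h2 end.
  have [? ?] := ih1 _ _ ltac:(eassumption); subst.
  by have [? ?] := ih2 _ _ ltac:(eassumption); subst.
Qed.

Lemma icost_le m e : (icost m e <= icost AllOps e)%N.
Proof.
have ble : (bookkeeping m <= 1)%N by case: m.
elim: e => /= [_|a e ih|e1 ih1 e2 ih2|e1 ih1 e2 ih2|e ih]; lia.
Qed.

Lemma rcost_le m e : (rcost m e <= rcost AllOps e)%N.
Proof.
elim: e => /= [e|a e|_ e1 ih1 e2 ih2]; last by lia.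
  by have := icost_le m e; case: m => /=; lia.
by have := icost_le m e; case: m => /=; lia.
Qed.

Lemma bcost_le m e : (bcost m e <= bcost AllOps e)%N.
Proof.
have ble : (bookkeeping m <= 1)%N by case: m.
elim: e => /= [e1 e2|e1 e2|e ih|e1 ih1 e2 ih2]; try lia.
  by have := icost_le m e1; have := icost_le m e2; lia.
by have := rcost_le m e1; have := rcost_le m e2; lia.
Qed.

(** An upper bound need only be shown when all operations are charged. *)
Lemma exec_le_AllOps m c s s' t : exec AllOps c s s' t ->
  exists2 t', (t' <= t)%N & exec m c s s' t'.
Proof.
have ble : (bookkeeping m <= 1)%N by case: m.
elim=> {c s s' t}.
- by move=> s; exists 0%N => //; constructor.
- move=> s a k e; eexists; last by constructor.
  by have := icost_le m k; have := icost_le m e; rewrite /=; lia.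
- move=> s a k e; eexists; last by constructor.
  by have := icost_le m k; have := rcost_le m e; rewrite /=; lia.
- move=> c1 c2 s1 s2 s3 t1 t2 _ [t1' le1 e1] _ [t2' le2 e2].
  by exists (t1' + t2')%N; [lia|apply: ESeq e1 e2].
- move=> b c1 c2 s s' t _ [t' le e].
  by exists (bcost m b + t')%N; [have := bcost_le m b; lia|constructor].
- by move=> b c s nb; exists (bcost m b); [exact: bcost_le|constructor].
- move=> b c s1 s2 s3 t1 t2 sb _ [t1' le1 e1] _ [t2' le2 e2].
  exists (bcost m b + t1' + t2')%N; last exact: EWhileTrue e1 e2.
  by have := bcost_le m b; lia.
Qed.

Definition halts_within c s (T : nat) (Q : state R -> Prop) : Prop :=
  exists s' t, [/\ exec AllOps c s s' t, (t <= T)%N & Q s'].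

Lemma within_seq c1 c2 s T1 T2 (Q1 Q : state R -> Prop) : halts_within c1 s T1 Q1 ->
  (forall s1, Q1 s1 -> halts_within c2 s1 T2 Q) -> halts_within (Seq c1 c2) s (T1 + T2) Q.
Proof.
move=> [s1 [t1 [e1 le1 q1]]] /(_ _ q1)[s2 [t2 [e2 le2 q2]]].
by exists s2, (t1 + t2)%N; split=> //; [apply: ESeq e1 e2|lia].
Qed.

Lemma within_weaken c s T T' (Q Q' : state R -> Prop) : halts_within c s T Q -> (T <= T')%N ->
  (forall s', Q s' -> Q' s') -> halts_within c s T' Q'.
Proof.
move=> [s1 [t1 [e1 le1 q1]]] TT QQ; exists s1, t1; split=> //; last exact: QQ.
exact: leq_trans TT.
Qed.

(** The natural number indexing the invariant bounds the number of remaining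
    iterations; leaving the loop early is allowed. *)
Lemma within_while b c (I : nat -> state R -> Prop) (T j : nat) s :
  (forall j s, I j s -> beval s b ->
     halts_within c s T (fun s' => exists2 j', (j' < j)%N & I j' s')) ->
  I j s ->
  halts_within (While b c) s (bcost AllOps b + j * (bcost AllOps b + T))
    (fun s' => (exists j', I j' s') /\ ~~ beval s' b).
Proof.
move=> step; elim/ltn_ind: j s => j ih s Ij.
case: (boolP (beval s b)) => sb; last first.
  exists s, (bcost AllOps b); split; [by constructor|lia|by split; [exists j|]].
have [s1 [t1 [e1 le1 [j' lt' Ij']]]] := step _ _ Ij sb.
have [s2 [t2 [e2 le2 q2]]] := ih _ lt' _ Ij'.
exists s2, (bcost AllOps b + t1 + t2)%N; split=> //; first exact: EWhileTrue e1 e2.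
nia.
Qed.

(** Straight-line code is handled by evaluation: [run] is its effect and
    [run_cost] charges both branches of every conditional, so that it does not
    depend on the state. *)
Fixpoint loop_free c : bool :=
  match c with
  | Seq c1 c2 | If _ c1 c2 => loop_free c1 && loop_free c2
  | While _ _ => false
  | _ => true
  end.

Fixpoint run c s : state R :=
  match c with
  | Skip | While _ _ => s
  | IStore a k e => State (update (imem s) a (ieval s k) (ieval s e)) (rmem s)
  | RStore a k e => State (imem s) (update (rmem s) a (ieval s k) (reval s e))
  | Seq c1 c2 => run c2 (run c1 s)
  | If b c1 c2 => if beval s b then run c1 s else run c2 s
  end.

Fixpoint run_cost c : nat :=
  match c with
  | Skip | While _ _ => 0
  | IStore a k e => 1 + icost AllOps k + icost AllOps e
  | RStore a k e => 1 + icost AllOps k + rcost AllOps e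
  | Seq c1 c2 => run_cost c1 + run_cost c2
  | If b c1 c2 => bcost AllOps b + (run_cost c1 + run_cost c2)
  end%N.

Lemma within_run c s (Q : state R -> Prop) :
  loop_free c -> Q (run c s) -> halts_within c s (run_cost c) Q.
Proof.
move=> lf Qs; suff [t [e le]] : exists t, exec AllOps c s (run c s) t /\ (t <= run_cost c)%N.
  by exists (run c s), t.
elim: c s lf {Qs} => //= [s|a k e s|a k e s|c1 ih1 c2 ih2 s|b c1 ih1 c2 ih2 s].
- by move=> _; exists 0%N; split=> //; constructor.
- by move=> _; eexists; split; first constructor.
- by move=> _; eexists; split; first constructor.
- case/andP=> /(ih1 s)[t1 [e1 le1]] /(ih2 (run c1 s))[t2 [e2 le2]].
  by exists (t1 + t2)%N; split; [exact: ESeq e1 e2|lia].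
case/andP=> /(ih1 s)[t1 [e1 le1]] /(ih2 s)[t2 [e2 le2]].
case: ifP => sb.
  by exists (bcost AllOps b + t1)%N; split; [constructor; rewrite sb|lia].
by exists (bcost AllOps b + t2)%N; split; [constructor; rewrite sb|lia].
Qed.

End Machine.

(** * Tournament trees *)

(** The program keeps its scalars in cell 0 of the integer arrays 4 to 9.  The
    points are numbered from 1 to n and the reference point is number 0: as it
    is larger than all points in all coordinates, it is the neutral element of
    minimisation, and 0 can stand for the absence of a point.  The coordinates
    of point [u] are kept in cells 3 u, 3 u + 1 and 3 u + 2 of the real array
    3. *)
Local Notation vSize := 4%N.
Local Notation vNode := 5%N.
Local Notation vStep := 6%N.
Local Notation vPoint := 7%N.
Local Notation vAcc := 8%N.
Local Notation vCand := 9%N.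

Definition ivar (a : nat) : iexp := ILoad a (IConst 0).
Definition iset (a : nat) (e : iexp) : cmd := IStore a (IConst 0) e.
Definition rkey (e : iexp) (c : nat) : rexp :=
  RLoad 3 (IAdd (IAdd (IAdd e e) e) (IConst c)).

Definition keep_better (c : nat) : cmd :=
  If (BLtR (rkey (ivar vCand) c) (rkey (ivar vAcc) c)) (iset vAcc (ivar vCand)) Skip.

(** A tournament tree over 2 ^ K positions is an integer array in heap order:
    the children of node [v] are 2 v and 2 v + 1, the leaves are the nodes from
    2 ^ K on, and an inner node holds the better of the points held by its
    children. *)
Definition climb_step (t c : nat) : cmd :=
  Seq (iset vAcc (ILoad t (IAdd (ivar vNode) (ivar vNode))))
 (Seq (iset vCand (ILoad t (IAdd (IAdd (ivar vNode) (ivar vNode)) (IConst 1))))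
 (Seq (keep_better c)
 (Seq (IStore t (ivar vNode) (ivar vAcc))
      (iset vNode (IHalf (ivar vNode)))))).

Definition tree_set (t c : nat) (pos val : iexp) : cmd :=
  Seq (Seq (iset vNode (IAdd (ivar vSize) pos))
      (Seq (IStore t (ivar vNode) val)
           (iset vNode (IHalf (ivar vNode)))))
      (While (BLtI (IConst 0) (ivar vNode)) (climb_step t c)).

(** The positions below a bound are the leaves to the left of a leaf.  Climbing
    from that leaf, the left siblings of the nodes that are right children
    cover exactly these leaves. *)
Definition prefix_step (t c : nat) : cmd :=
  Seq (If (BLtI (IAdd (IHalf (ivar vNode)) (IHalf (ivar vNode))) (ivar vNode))
          (Seq (iset vCand (ILoad t (ISub (ivar vNode) (IConst 1)))) (keep_better c))
          Skip)
      (iset vNode (IHalf (ivar vNode))).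

Definition tree_prefix (t c : nat) (bound : iexp) : cmd :=
  Seq (Seq (iset vNode (IAdd (ivar vSize) bound)) (iset vAcc (IConst 0)))
      (While (BLtI (IConst 1) (ivar vNode)) (prefix_step t c)).

Section Trees.
Variable R : realType.
Implicit Types (s : state R).

Definition mkey (m : nat -> nat -> R) (u c : nat) : R := m 3 (u + u + u + c)%N.

Definition better m (c u v : nat) : nat := if mkey m v c < mkey m u c then v else u.

Lemma run_seq c1 c2 s : run (Seq c1 c2) s = run c2 (run c1 s).
Proof. by []. Qed.

Lemma run_keep_better c s : run (keep_better c) s =
  State (update (imem s) vAcc 0 (better (rmem s) c (imem s vAcc 0) (imem s vCand 0))) (rmem s).
Proof.
rewrite /= /better /mkey /=; case: ifP => _ //; case: s => im rm /=; congr State.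
apply/funext => a; apply/funext => k; rewrite /update.
by case: ifP => [/andP[/eqP -> /eqP ->]|].
Qed.

Definition heap_eq m (c : nat) (f : nat -> nat) (u : nat) : Prop :=
  f u = better m c (f (u + u)%N) (f (u + u + 1)%N).

Definition frame (X : seq nat) s s' : Prop :=
  (forall a, a \notin X -> forall k, imem s' a k = imem s a k) /\ rmem s' = rmem s.

Lemma frame_trans X s1 s2 s3 : frame X s1 s2 -> frame X s2 s3 -> frame X s1 s3.
Proof.
move=> [f12 r12] [f23 r23]; split=> [a aX k|]; last by rewrite r23.
by rewrite f23 // f12.
Qed.

Lemma frame_sub X X' s s' : {subset X <= X'} -> frame X s s' -> frame X' s s'.
Proof.
move=> XX [f r]; split=> // a aX k; apply: f.
by apply: contra aX; exact: XX.
Qed.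

Lemma scratch_names t : (9 < t)%N ->
  ((t == 4%N) = false) * ((t == 5%N) = false) * ((t == 6%N) = false) *
  ((t == 7%N) = false) * ((t == 8%N) = false) * ((t == 9%N) = false) *
  ((4%N == t) = false) * ((5%N == t) = false) * ((6%N == t) = false) *
  ((7%N == t) = false) * ((8%N == t) = false) * ((9%N == t) = false).
Proof. by move=> t9; do !split; lia. Qed.

(** During the climb the heap equation can only fail at the current node: it is
    restored there, which can only break it at the parent. *)
Lemma tree_set_spec t c pos val : (9 < t)%N -> exists C : nat,
  forall s (K p w : nat),
  imem s vSize 0 = (2 ^ K)%N -> ieval s pos = p -> (p < 2 ^ K)%N ->
  (forall x, ieval (State (update (imem s) vNode 0 x) (rmem s)) val = w) ->
  (forall u, (0 < u < 2 ^ K)%N -> heap_eq (rmem s) c (imem s t) u) ->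
  halts_within (tree_set t c pos val) s (C * K.+1) (fun s' =>
    [/\ frame [:: t; vNode; vAcc; vCand] s s',
        (forall u, (0 < u < 2 ^ K)%N -> heap_eq (rmem s) c (imem s' t) u) &
        forall x, (x < 2 ^ K)%N ->
          imem s' t (2 ^ K + x) = if x == p then w else imem s t (2 ^ K + x)]).
Proof.
move=> t9.
have tn := scratch_names t9.
pose pre := Seq (iset vNode (IAdd (ivar vSize) pos))
      (Seq (IStore t (ivar vNode) val)
           (iset vNode (IHalf (ivar vNode)))).
exists (run_cost pre + (bcost AllOps (BLtI (IConst 0) (ivar vNode)) + run_cost (climb_step t c)))%N.
move=> s K p w sK sp pK sval heap.
pose I (j : nat) (s1 : state R) := [/\ (imem s1 vNode 0 < 2 ^ j)%N,
  (imem s1 vNode 0 < 2 ^ K)%N,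
  frame [:: t; vNode; vAcc; vCand] s s1,
  (forall u, (0 < u < 2 ^ K)%N -> u <> imem s1 vNode 0 -> heap_eq (rmem s) c (imem s1 t) u) &
  forall x, (x < 2 ^ K)%N ->
          imem s1 t (2 ^ K + x) = if x == p then w else imem s t (2 ^ K + x)].
have K0 : (0 < 2 ^ K)%N by rewrite expn_gt0.
apply: within_weaken; first apply: within_seq.
- apply: (within_run (Q := I K)) => //.
  rewrite /I /= /update /= !tn //= eqxx sp sval sK.
  split.
  + by rewrite ltn_half_double; lia.
  + by rewrite ltn_half_double; lia.
  + split=> //= a; rewrite !inE !negb_or => /and4P[at_ a5 a8 a9] k.
    by rewrite (negbTE at_) (negbTE a5).
  + move=> u uK /eqP nu; rewrite /heap_eq /=.
    have -> : (u == (2 ^ K + p)%N) = false by lia.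
    have -> : ((u + u)%N == (2 ^ K + p)%N) = false by lia.
    have -> : ((u + u + 1)%N == (2 ^ K + p)%N) = false by lia.
    exact: heap.
  + by move=> x xK; rewrite eqn_add2l.
- move=> s1 I1; apply: (within_while (I := I) (T := run_cost (climb_step t c)) (j := K)) I1.
  move=> j {}s1 [vj vK fr hp lv] /= v0.
  apply: within_run => //.
  exists j.-1; first by case: j vj => //=; lia.
  have mk u : mkey (rmem s1) u c = mkey (rmem s) u c by rewrite /mkey; case: fr => _ ->.
  set v := imem s1 vNode 0 in vj vK v0 hp.
  have fr2 : frame [:: t; vNode; vAcc; vCand] s1 (run (climb_step t c) s1).
    rewrite /climb_step !run_seq run_keep_better; split=> // a.
    rewrite !inE !negb_or => /and4P[/negbTE at_ /negbTE a5 /negbTE a8 /negbTE a9] k.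
    by rewrite /update /= /update /= a5 at_ a8 a9.
  have v2 : imem (run (climb_step t c) s1) vNode 0 = v./2.
    by rewrite /climb_step !run_seq run_keep_better /= /update /= !tn.
  have t2 k : imem (run (climb_step t c) s1) t k = if k == v then
      better (rmem s) c (imem s1 t (v + v)%N) (imem s1 t (v + v + 1)%N) else imem s1 t k.
    rewrite /climb_step !run_seq run_keep_better /= /update /= !tn /= eqxx.
    by rewrite /better -!mk.
  rewrite /I v2; split.
  + by rewrite ltn_half_double; case: (j) vj => [|j'] /=; rewrite ?expnS; lia.
  + by lia.
  + exact: frame_trans fr fr2.
  + move=> u uK nu; rewrite /heap_eq !t2.
    have [->|/eqP uv] := eqVneq u v.
      by rewrite !ifN //; apply/eqP; lia.
    rewrite !ifN; [exact: hp|apply/eqP; lia|apply/eqP; lia].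
  + by move=> x xK; rewrite t2 ifN ?lv //; apply/eqP; lia.
- rewrite /pre; nia.
move=> s' [[j [_ _ fr hp lv]]] /=; rewrite -leqNgt leqn0 => /eqP v0; split=> //.
by move=> u uK; apply: hp => //; lia.
Qed.

(** The number 0 stands for the reference point, so [u] may be 0; when the
    reference point is larger than all others this means that [P] is empty. *)
Definition best m (c : nat) (P : nat -> Prop) (u : nat) : Prop :=
  (u <> 0%N -> P u) /\ forall w, w <> 0%N -> P w -> mkey m u c <= mkey m w c.

Lemma best_better m c (P1 P2 P : nat -> Prop) u1 u2 :
  best m c P1 u1 -> best m c P2 u2 -> (forall w, w <> 0%N -> P w <-> P1 w \/ P2 w) ->
  best m c P (better m c u1 u2).
Proof.
move=> [p1 m1] [p2 m2] PE; rewrite /better; split.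
  by case: ifP => _ u0; apply/PE => //; [right; exact: p2|left; exact: p1].
move=> w w0 /PE => /(_ w0)[/(m1 _ w0)|/(m2 _ w0)] wle; case: ltP => // cmp.
  by rewrite (le_trans (ltW cmp)).
by rewrite (le_trans cmp).
Qed.

Lemma best_ext m c (P P' : nat -> Prop) u :
  (forall w, w <> 0%N -> P w <-> P' w) -> best m c P u -> best m c P' u.
Proof.
move=> PP [pu mu]; split=> [u0|w w0 /PP Pw]; first by apply/PP => //; exact: pu.
by apply: mu => //; exact: Pw.
Qed.

Lemma heap_best m c (f : nat -> nat) (K : nat) :
  (forall u, (0 < u < 2 ^ K)%N -> heap_eq m c f u) ->
  forall h v, (0 < v)%N -> (v.+1 * 2 ^ h <= 2 ^ K.+1)%N ->
  best m c (fun w => exists2 y, (v * 2 ^ h <= y < v.+1 * 2 ^ h)%N & f y = w) (f v).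
Proof.
move=> heap; elim=> [|h ih] v v0 vK.
  split=> [_|w _ [y yv <-]]; first by exists v; lia.
  by have -> : y = v by lia.
have h0 : (0 < 2 ^ h)%N by rewrite expn_gt0.
rewrite !expnS in vK.
rewrite heap; last by rewrite v0 /=; nia.
apply: best_better (ih (v + v)%N _ _) (ih (v + v + 1)%N _ _) _; rewrite ?expnS; try nia.
move=> w _; split=> [[y yv <-]|[[y yv <-]|[y yv <-]]].
- have [ylt|yge] := ltnP y ((v + v).+1 * 2 ^ h); [left|right]; exists y => //; nia.
- by exists y => //; nia.
- by exists y => //; nia.
Qed.

(** After [h] steps the accumulator is optimal over the leaves between the
    leftmost leaf below the current node and the bound. *)
Lemma tree_prefix_spec t c bound : (9 < t)%N -> exists C : nat,
  forall s (K b : nat),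
  imem s vSize 0 = (2 ^ K)%N -> ieval s bound = b -> (b < 2 ^ K)%N ->
  (forall u, (0 < u < 2 ^ K)%N -> heap_eq (rmem s) c (imem s t) u) ->
  halts_within (tree_prefix t c bound) s (C * K.+1) (fun s' =>
    frame [:: vNode; vAcc; vCand] s s' /\
    best (rmem s) c (fun w => exists2 x, (x < b)%N & imem s t (2 ^ K + x) = w) (imem s' vAcc 0)).
Proof.
move=> t9; have tn := scratch_names t9.
pose pre := Seq (iset vNode (IAdd (ivar vSize) bound)) (iset vAcc (IConst 0)).
exists (run_cost pre + (bcost AllOps (BLtI (IConst 1) (ivar vNode)) + run_cost (prefix_step t
    c)))%N.
move=> s K b sK sb bK heap.
pose I (j : nat) (s1 : state R) := let v := imem s1 vNode 0 in exists h, [/\ (h + j = K)%N,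
  (v * 2 ^ h <= 2 ^ K + b < v.+1 * 2 ^ h)%N,
  frame [:: vNode; vAcc; vCand] s s1 &
  best (rmem s) c (fun w => exists2 y, (v * 2 ^ h <= y < 2 ^ K + b)%N & imem s t y = w)
    (imem s1 vAcc 0)].
(* The node visited after [h] steps is the ancestor of leaf 2 ^ K + b that is
   [h] levels above it; its leftmost leaf is v * 2 ^ h. *)
have K0 : (0 < 2 ^ K)%N by rewrite expn_gt0.
apply: within_weaken; first apply: within_seq.
- apply: (within_run (Q := I K)) => //.
  rewrite /I /= /update /= sb sK; exists 0%N; split=> //.
  + by rewrite expn0; lia.
  + split=> //= a; rewrite !inE !negb_or => /and3P[/negbTE a5 /negbTE a8 /negbTE a9] k.
    by rewrite a5 a8.
  + by split=> // w _ [y]; lia.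
- move=> s1 I1; apply: (within_while (I := I) (T := run_cost (prefix_step t c)) (j := K)) I1.
  move=> j {}s1 [h [hj]] /=; set v := imem s1 vNode 0 => vh fr bst v1.
  have h0 : (0 < 2 ^ h)%N by rewrite expn_gt0.
  have j0 : (0 < j)%N.
    rewrite lt0n; apply/eqP => j0; move: hj; rewrite j0 addn0 => hK; subst h; nia.
  apply: within_run => //; exists j.-1; first lia.
  have rt k : imem s1 t k = imem s t k by case: fr => -> //; rewrite !inE !tn.
  have rm : rmem s1 = rmem s by case: fr.
  pose acc := if (v./2 + v./2 < v)%N then
    better (rmem s) c (imem s1 vAcc 0) (imem s t (v - 1)%N) else imem s1 vAcc 0.
  have E : [/\ frame [:: vNode; vAcc; vCand] s1 (run (prefix_step t c) s1),
      imem (run (prefix_step t c) s1) vNode 0 = v./2 &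
      imem (run (prefix_step t c) s1) vAcc 0 = acc].
    rewrite /prefix_step run_seq /acc -/v.
    have -> : run (If (BLtI (IAdd (IHalf (ivar vNode)) (IHalf (ivar vNode))) (ivar vNode))
          (Seq (iset vCand (ILoad t (ISub (ivar vNode) (IConst 1)))) (keep_better c))
          Skip) s1 = if (v./2 + v./2 < v)%N then run (keep_better c)
            (run (iset vCand (ILoad t (ISub (ivar vNode) (IConst 1)))) s1) else s1 by [].
    case: ifP => _; rewrite ?run_keep_better /=; split=> //.
    - split=> [a|//]; rewrite !inE !negb_or => /and3P[/negbTE a5 /negbTE a8 /negbTE a9] k.
      by rewrite /= /update /= a5 a8 a9.
    - by rewrite /update /= /update /= ?tn -/v rt /better /mkey /= rm.
    - split=> [a|//]; rewrite !inE !negb_or => /and3P[/negbTE a5 /negbTE a8 /negbTE a9] k.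
      by rewrite /= /update /= a5.
  move: E; set s2 := run _ _ => -[fr2 v2 acc2]; exists h.+1; rewrite v2 acc2.
  split; [lia| |exact: frame_trans fr fr2|].
    by rewrite expnS; nia.
  rewrite /acc expnS; case: ifP => odd_v.
    apply: best_better bst (heap_best heap (h := h) (v := (v - 1)%N) _ _) _; [lia| |].
      by rewrite expnS; nia.
    move=> w _; split=> [[y yv <-]|[[y yv <-]|[y yv <-]]].
    + have [ylt|yge] := ltnP y (v * 2 ^ h); [right|left]; exists y => //; nia.
    + by exists y => //; nia.
    + by exists y => //; nia.
  apply: best_ext bst => w _.
  have -> : (v./2 * (2 * 2 ^ h) = v * 2 ^ h)%N by nia.
  by [].
- rewrite /pre; nia.
move=> s' [[j [h [hj vh fr bst]]]] /=; rewrite -leqNgt => v1; split=> //.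
have h0 : (0 < 2 ^ h)%N by rewrite expn_gt0.
have hK : h = K.
  have : (2 ^ K < 2 ^ h.+1)%N by rewrite expnS; nia.
  by rewrite ltn_exp2l //; lia.
subst h; apply: best_ext bst => w _.
have -> : (imem s' vNode 0 * 2 ^ K = 2 ^ K)%N.
  by case: (imem s' vNode 0) vh v1 => [|[|v]] vh v1; lia.
split=> [[y yv <-]|[x xb <-]].
  by exists (y - 2 ^ K)%N; [lia|congr imem; lia].
by exists (2 ^ K + x)%N => //; lia.
Qed.

End Trees.

(** * Sorting and dominance queries *)

Definition for_points (body : cmd) : cmd :=
  Seq (iset vStep (IConst 1))
      (While (BNot (BLtI (ivar 0) (ivar vStep)))
             (Seq body (iset vStep (IAdd (ivar vStep) (IConst 1))))).

Definition for_overhead : nat :=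
  (run_cost (iset vStep (IConst 1)) + bcost AllOps (BNot (BLtI (ivar 0) (ivar vStep))) +
   run_cost (iset vStep (IAdd (ivar vStep) (IConst 1))))%N.

(** Tournament sort: fill the tree, then repeatedly take the point at the root
    and clear its leaf.  The array [p] receives the sorted points and [r] their
    ranks, counted from 1. *)
Definition sort_points (t p r c : nat) : cmd :=
  Seq (for_points (tree_set t c (ivar vStep) (ivar vStep)))
      (for_points
        (Seq (Seq (iset vPoint (ILoad t (IConst 1)))
             (Seq (IStore p (ivar vStep) (ivar vPoint))
                  (IStore r (ivar vPoint) (ivar vStep))))
             (tree_set t c (ivar vPoint) (IConst 0)))).

(** Answers, for every point u, the query which point minimises coordinate [s]
    among those that precede u in the order [p] and whose rank in [r] is less
    than that of the point [w] u.  The points inserted into the tree are those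
    that precede u, at the positions given by [r]. *)
Definition sweep (t p r w d s : nat) : cmd :=
  for_points
    (Seq (Seq (iset vPoint (ILoad p (ivar vStep)))
              (tree_prefix t s (ILoad r (ILoad w (ivar vPoint)))))
    (Seq (IStore d (ivar vPoint) (ivar vAcc))
         (tree_set t s (ILoad r (ivar vPoint)) (ivar vPoint)))).

Section Loops.
Variable R : realType.
Implicit Types (s : state R).

(** Loop invariants are stated for a state in which the loop variable already
    has its next value. *)
Definition set_step s (k : nat) : state R :=
  State (update (imem s) vStep 0 k) (rmem s).

Lemma frame_set_step X s k : vStep \in X -> frame X s (set_step s k).
Proof.
move=> X6; split=> // a aX j; rewrite /= /update.
by case: eqP => // a6; move: aX; rewrite a6 X6.
Qed.

Lemma set_step_neq s k a j : a != vStep -> imem (set_step s k) a j = imem s a j.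
Proof. by move=> /negbTE a6; rewrite /= /update a6. Qed.

Lemma within_for body T n (J : nat -> state R -> Prop) s :
  imem s 0 0 = n -> J 1%N (set_step s 1) ->
  (forall k s1, (1 <= k <= n)%N -> imem s1 0 0 = n -> imem s1 vStep 0 = k -> J k s1 ->
    halts_within body s1 T (fun s2 =>
      [/\ imem s2 0 0 = n, imem s2 vStep 0 = k & J k.+1 (set_step s2 k.+1)])) ->
  halts_within (for_points body) s ((for_overhead + T) * n.+1) (J n.+1).
Proof.
move=> sn J1 step.
pose I j s1 := exists k, [/\ (k + j = n.+1)%N, (1 <= k)%N, imem s1 0 0 = n,
  imem s1 vStep 0 = k & J k s1].
apply: within_weaken; first apply: within_seq.
- apply: (within_run (Q := I n)) => //.
  by exists 1%N; split.
- move=> s1; apply: within_while => j {}s1 [k [kj k1 s1n s1k Jk]] /=.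
  rewrite s1n s1k -leqNgt => kn.
  apply: within_weaken; first apply: within_seq.
  + by apply: step Jk => //; rewrite k1.
  + move=> s2 [s2n s2k Jk2]; apply: (within_run (Q := fun s' => exists2 j',
      (j' < j)%N & I j' s')) => //.
    exists j.-1; first lia.
    exists k.+1; rewrite /= s2k addn1; split=> //; lia.
  + exact: leqnn.
  + by [].
- rewrite /for_overhead; nia.
move=> s' [[j [k [kj k1 sn' sk Jk]]]] /=; rewrite negbK sn' sk => nk.
by have <- : k = n.+1 by lia.
Qed.

(** Ranks are counted from 1; the reference point gets rank 0, so that no point
    has a smaller rank and a query for it has an empty range. *)
Definition sorted_by (m : nat -> nat -> R) (n c : nat) (p r : nat -> nat) : Prop :=
  [/\ r 0%N = 0%N,
      forall k, (1 <= k <= n)%N -> (1 <= p k <= n)%N /\ r (p k) = k,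
      forall u, (1 <= u <= n)%N -> (1 <= r u <= n)%N /\ p (r u) = u &
      forall u w, (1 <= u <= n)%N -> (1 <= w <= n)%N ->
        mkey m w c < mkey m u c -> (r w < r u)%N].

(** A point has been extracted exactly if its rank is not 0.  Every point below
    an extracted point has been extracted before it, as the root holds the least
    remaining point.  The root is not empty before the last round, since
    fewer than n ranks have been given. *)
Lemma sort_spec t p r c : (9 < t)%N -> (9 < p)%N -> (9 < r)%N ->
  uniq [:: t; p; r] -> exists C : nat,
  forall s (K n : nat),
  imem s 0 0 = n -> imem s vSize 0 = (2 ^ K)%N -> (n < 2 ^ K)%N ->
  (forall k, imem s t k = 0%N) -> (forall k, imem s r k = 0%N) ->
  (forall u, (1 <= u <= n)%N -> mkey (rmem s) u c < mkey (rmem s) 0 c) ->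
  (forall u w, (1 <= u <= n)%N -> (1 <= w <= n)%N -> u <> w ->
     mkey (rmem s) u c <> mkey (rmem s) w c) ->
  halts_within (sort_points t p r c) s (C * (n.+1 * K.+1)) (fun s' =>
    frame [:: t; p; r; vNode; vStep; vPoint; vAcc; vCand] s s' /\
    sorted_by (rmem s) n c (imem s' p) (imem s' r)).
Proof.
move=> t9 p9 r9; rewrite /= !inE negb_or => /and3P[/andP[tp tr] pr _].
have tn := scratch_names t9.
have [C1 spec1] := @tree_set_spec R t c (ivar vStep) (ivar vStep) t9.
have [C2 spec2] := @tree_set_spec R t c (ivar vPoint) (IConst 0) t9.
pose pre := Seq (iset vPoint (ILoad t (IConst 1)))
             (Seq (IStore p (ivar vStep) (ivar vPoint))
                  (IStore r (ivar vPoint) (ivar vStep))).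
exists (2 * for_overhead + C1 + C2 + run_cost pre)%N => s K n sn sK nK t0 r0 kref kinj.
pose X := [:: t; p; r; vNode; vStep; vPoint; vAcc; vCand].
pose J1 k s1 := [/\ frame X s s1, forall j, imem s1 r j = 0%N,
  forall u, (0 < u < 2 ^ K)%N -> heap_eq (rmem s) c (imem s1 t) u &
  forall x, (x < 2 ^ K)%N -> imem s1 t (2 ^ K + x) = if (0 < x < k)%N then x else 0%N].
pose J2 k s1 := [/\ frame X s s1,
  (forall u, (0 < u < 2 ^ K)%N -> heap_eq (rmem s) c (imem s1 t) u) /\ imem s1 r 0 = 0%N,
  forall x, (x < 2 ^ K)%N -> imem s1 t (2 ^ K + x) =
    if (0 < x <= n)%N && (imem s1 r x == 0%N) then x else 0%N,
  (forall j, (1 <= j < k)%N -> (1 <= imem s1 p j <= n)%N /\ imem s1 r (imem s1 p j) = j) /\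
  (forall u, (1 <= u <= n)%N -> imem s1 r u <> 0%N ->
     (1 <= imem s1 r u < k)%N /\ imem s1 p (imem s1 r u) = u) &
  forall u w, (1 <= u <= n)%N -> (1 <= w <= n)%N -> imem s1 r u <> 0%N ->
     mkey (rmem s) w c < mkey (rmem s) u c ->
     imem s1 r w <> 0%N /\ (imem s1 r w < imem s1 r u)%N].
apply: within_weaken; first apply: within_seq.
- apply: (@within_for _ (C1 * K.+1) n J1) => //.
  + split=> [|j|u uK|x xK]; first by apply: frame_set_step; rewrite !inE !orbT.
    * by rewrite set_step_neq ?r0 //; lia.
    * by rewrite /heap_eq !set_step_neq ?tn // !t0 /better ltxx.
    * by rewrite set_step_neq ?tn // t0; case: ifP => //; lia.
  + move=> k s1 k1n s1n s1k [fr s1r s1h s1l].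
    have rm : rmem s1 = rmem s by case: fr.
    apply: within_weaken; first apply: (spec1 s1 K k k) => //.
    * by case: fr => + _ => ->; rewrite // !inE ?tn; lia.
    * lia.
    * by rewrite rm.
    * exact: leqnn.
    * rewrite rm => s2 [fr2 s2h s2l]; case: (fr2) => fr2i _.
      split; [by rewrite fr2i // !inE ?tn; lia|by rewrite fr2i // !inE ?tn; lia|].
      have frs : frame X s (set_step s2 k.+1).
        apply: (frame_trans fr); apply: (frame_trans (s2 := s2)); last first.
          by apply: frame_set_step; rewrite !inE !orbT.
        by apply: frame_sub fr2 => a; rewrite !inE; lia.
      split=> // [j|u uK|x xK].
      - by rewrite set_step_neq ?fr2i ?s1r ?inE //; lia.
      - by rewrite /heap_eq !set_step_neq ?tn //; exact: s2h.
      - rewrite set_step_neq ?tn // s2l //.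
        case: eqP => [->|xk]; first by case: ifP => //; lia.
        by rewrite s1l //; case: ifP; case: ifP => //; lia.
- move=> s1 [fr s1r s1h s1l].
  have s1n : imem s1 0 0 = n by case: fr => -> //; rewrite !inE ?tn; lia.
  apply: (@within_for _ (run_cost pre + C2 * K.+1) n J2) => //.
  + split=> [||x xK| |u w u1 w1].
    * by apply: (frame_trans fr); apply: frame_set_step; rewrite !inE !orbT.
    * split=> [u uK|]; first by rewrite /heap_eq !set_step_neq ?tn //; exact: s1h.
      by rewrite set_step_neq //; lia.
    * rewrite !set_step_neq ?tn //; last lia.
      by rewrite s1l // s1r eqxx andbT ltnS.
    * split=> [j|u u1]; first lia.
      by rewrite set_step_neq //; lia.
    * by rewrite set_step_neq //; lia.
  + move=> k s2 k1n s2n s2k [fr2 [s2h s2r0] s2l [s2p s2r] s2o].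
    have rm2 : rmem s2 = rmem s by case: fr2.
    have s2K : imem s2 vSize 0 = (2 ^ K)%N.
      by case: fr2 => -> //; rewrite !inE ?tn; lia.
    pose id := imem s2 t 1.
    have K1 : (1 < 2 ^ K)%N by lia.
    have [idP id_min] : best (rmem s) c (fun w => (1 <= w <= n)%N /\ imem s2 r w = 0%N) id.
      apply: best_ext (heap_best s2h (h := K) (v := 1) _ _) => //; last by rewrite expnS; lia.
      move=> w w0; split=> [[y yK wE]|[w1n rw]].
        move: w0; rewrite -wE; have := s2l (y - 2 ^ K)%N; rewrite subnKC; last lia.
        have /[swap] /[apply] -> : (y - 2 ^ K < 2 ^ K)%N by lia.
        by case: ifP => // /andP[y1 /eqP ry] _.
      exists (2 ^ K + w)%N; first lia.
      rewrite s2l; last lia.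
      by rewrite ifT // rw eqxx andbT; lia.
    (* If the root held no point, all n points would have ranks less than k. *)
    have id0 : id <> 0%N.
      move=> id0.
      have all_r u : (1 <= u <= n)%N -> imem s2 r u <> 0%N.
        move=> u1 ru; have := id_min u; rewrite id0.
        have ul := kref u u1; move: ul; rewrite ltNge => /negP ul ul2; apply: ul;
            apply: ul2 => //; lia.
      have : uniq [seq imem s2 r u | u <- iota 1 n].
        rewrite map_inj_in_uniq ?iota_uniq // => u w; rewrite !mem_iota => u1 w1 uw.
        have u1' : (1 <= u <= n)%N by lia.
        have w1' : (1 <= w <= n)%N by lia.
        have [_ <-] := s2r u u1' (all_r u u1').
        by rewrite uw; have [_ ->] := s2r w w1' (all_r w w1').
      move/uniq_leq_size => /(_ (iota 1 k.-1)); rewrite size_map !size_iota.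
      suff : {subset [seq imem s2 r u | u <- iota 1 n] <= iota 1 k.-1} by move=> sub /(_ sub); lia.
      move=> j /mapP[u]; rewrite !mem_iota => u1 ->.
      have u1' : (1 <= u <= n)%N by lia.
      by have [] := s2r u u1' (all_r u u1'); lia.
    have [id1n rid] := idP id0.
    pose s3 := run pre s2.
    have s3p j : imem s3 p j = if j == k then id else imem s2 p j.
      rewrite /s3 /pre /= /update /= (scratch_names p9) (negbTE pr) eqxx /=.
      by rewrite s2k (scratch_names p9) eq_sym.
    have s3r j : imem s3 r j = if j == id then k else imem s2 r j.
      rewrite /s3 /pre /= /update /= eqxx [r == p]eq_sym (negbTE pr).
      by rewrite !(scratch_names p9) !(scratch_names r9) /= s2k.
    have s3o a j : a != p -> a != r -> a != vPoint -> imem s3 a j = imem s2 a j.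
      by move=> /negbTE ap /negbTE ar /negbTE a7; rewrite /s3 /pre /= /update /= ap ar a7.
    have s3i : imem s3 vPoint 0 = id.
      by rewrite /s3 /pre /= /update /= !(scratch_names p9) !(scratch_names r9).
    have rm3 : rmem s3 = rmem s by rewrite -rm2.
    have fr3 : frame X s s3.
      apply: (frame_trans fr2); split=> [a|]; last by rewrite rm3.
      by rewrite !inE => aX j; apply: s3o; lia.
    apply: within_weaken; first apply: within_seq.
    * exact: (within_run (Q := fun s' => s' = s3)).
    * move=> _ ->; apply: (spec2 s3 K id 0%N) => //.
      - by rewrite s3o //; lia.
      - lia.
      - by move=> u uK; rewrite rm3 /heap_eq !s3o; try lia; exact: s2h.
    * exact: leqnn.
    * rewrite rm3 => s4 [fr4 s4h s4l]; case: (fr4) => fr4i _.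
      have s4o a j : a != t -> a != vNode -> a != vAcc -> a != vCand -> imem s4 a j = imem s3 a j.
        by move=> *; apply: fr4i; rewrite !inE; lia.
      have s4n : imem s4 0 0 = n by rewrite s4o ?s3o //; lia.
      have s4k : imem s4 vStep 0 = k by rewrite s4o ?s3o //; lia.
      have s4p j : imem (set_step s4 k.+1) p j = if j == k then id else imem s2 p j.
        by rewrite set_step_neq ?s4o ?s3p //; lia.
      have s4r j : imem (set_step s4 k.+1) r j = if j == id then k else imem s2 r j.
        by rewrite set_step_neq ?s4o ?s3r //; lia.
      split=> //; split.
      - apply: (frame_trans fr3); apply: (frame_trans (s2 := s4)); last first.
          by apply: frame_set_step; rewrite !inE !orbT.
        by apply: frame_sub fr4 => a; rewrite !inE; lia.
      - split=> [u uK|]; first by rewrite /heap_eq !set_step_neq ?tn //; exact: s4h.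
        by rewrite s4r ifN //; lia.
      - move=> x xK; rewrite s4r set_step_neq ?tn // s4l //.
        case: eqP => [->|xid]; first by rewrite ifN //; lia.
        by rewrite s3o ?s2l //; lia.
      - split=> [j jk|u u1n].
          rewrite s4p s4r; case: eqP => [->|jk']; first by rewrite eqxx.
          have j1k : (1 <= j < k)%N by lia.
          have [pj1 rpj] := s2p j j1k; rewrite ifN //.
          apply/eqP => e; move: rpj; rewrite e rid; lia.
        rewrite s4r s4p; case: eqP => [->|uid] ru; first by rewrite eqxx; lia.
        have [ru1 pru] := s2r u u1n ru; rewrite ifN; last lia.
        by split=> //; lia.
      - move=> u w u1n w1n; rewrite !s4r; case: eqP => [->|uid] ru wu.
          have rw : imem s2 r w <> 0%N.
            move=> rw; have := id_min w; rewrite leNgt wu => h.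
            by have // : false by apply: h => //; lia.
          case: eqP => [wid|wid]; first by move: wu; rewrite wid ltxx.
          by have [] := s2r w w1n rw; lia.
        have [rw rwu] := s2o u w u1n w1n ru wu; rewrite ifN //.
        by apply/eqP => wid; apply: rw; rewrite wid.
- rewrite /pre; nia.
move=> s' [fr [h r00] l [sp sr] so]; split=> //.
(* The n sorted points are distinct, so every point is one of them. *)
have rnz u : (1 <= u <= n)%N -> imem s' r u <> 0%N.
  move=> u1n ru.
  have pu : uniq [seq imem s' p j | j <- iota 1 n].
    rewrite map_inj_in_uniq ?iota_uniq // => i j; rewrite !mem_iota => i1 j1 ij.
    have [_ <-] : (1 <= imem s' p i <= n)%N /\ imem s' r (imem s' p i) = i by apply: sp; lia.
    by rewrite ij; have [_ ->] : (1 <= imem s' p j <= n)%N /\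
        imem s' r (imem s' p j) = j by apply: sp; lia.
  have sub : {subset [seq imem s' p j | j <- iota 1 n] <= iota 1 n}.
    move=> j /mapP[i]; rewrite !mem_iota => i1 ->.
    have [] : (1 <= imem s' p i <= n)%N /\ imem s' r (imem s' p i) = i by apply: sp; lia.
    lia.
  have szle : (size (iota 1 n) <= size [seq imem s' p j | j <- iota 1 n])%N by rewrite size_map.
  have [_ pE] := uniq_min_size pu sub szle.
  have : u \in iota 1 n by rewrite mem_iota; lia.
  rewrite -pE => /mapP[j]; rewrite mem_iota => j1 uE.
  have [] : (1 <= imem s' p j <= n)%N /\ imem s' r (imem s' p j) = j by apply: sp; lia.
  rewrite -uE ru; lia.
split=> //.
- by move=> u u1n; have := sr u u1n (rnz u u1n); lia.
move=> u w u1n w1n; case/so => //.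
exact: rnz.
Qed.


Lemma sorted_lt (m : nat -> nat -> R) n c p r u w : sorted_by m n c p r ->
  (forall u w, (1 <= u <= n)%N -> (1 <= w <= n)%N -> u <> w -> mkey m u c <> mkey m w c) ->
  (1 <= u <= n)%N -> (1 <= w <= n)%N -> (r w < r u)%N = (mkey m w c < mkey m u c).
Proof.
move=> [_ _ _ so] kinj u1 w1; apply/idP/idP => [rwu|]; last exact: so.
rewrite lt_neqAle; apply/andP; split.
  by apply/eqP; apply: kinj => // wu; move: rwu; rewrite wu ltnn.
by rewrite leNgt; apply/negP => /(so _ _ w1 u1); lia.
Qed.

(** Every leaf holds 0 or the point whose rank it is, and it holds the point
    exactly if that point precedes the current one in the order [pp]. *)
Lemma sweep_spec t pp rq w d c : (9 < t)%N -> (9 < d)%N ->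
  all (fun a => (9 < a)%N && (a != t) && (a != d)) [:: pp; rq; w] -> t != d -> exists C : nat,
  forall s (K n cp cq : nat) (pq rp : nat -> nat),
  imem s 0 0 = n -> imem s vSize 0 = (2 ^ K)%N -> (n < 2 ^ K)%N ->
  (forall k, imem s t k = 0%N) ->
  sorted_by (rmem s) n cp (imem s pp) rp -> sorted_by (rmem s) n cq pq (imem s rq) ->
  (forall u, (1 <= u <= n)%N -> (imem s w u <= n)%N) ->
  halts_within (sweep t pp rq w d c) s (C * (n.+1 * K.+1)) (fun s' =>
    frame [:: t; d; vNode; vStep; vPoint; vAcc; vCand] s s' /\
    forall u, (1 <= u <= n)%N -> best (rmem s) c (fun v =>
      [/\ (1 <= v <= n)%N, (rp v < rp u)%N & (imem s rq v < imem s rq (imem s w u))%N])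
      (imem s' d u)).
Proof.
move=> t9 d9 /and4P[/andP[/andP[pp9 ppt] ppd] /andP[/andP[rq9 rqt] rqd]
  /andP[/andP[w9 wt] wd] _] td.
have tn := scratch_names t9; have dn := scratch_names d9.
have rqn := scratch_names rq9; have wn := scratch_names w9; have ppn := scratch_names pp9.
have [C1 spec1] := @tree_prefix_spec R t c (ILoad rq (ILoad w (ivar vPoint))) t9.
have [C2 spec2] := @tree_set_spec R t c (ILoad rq (ivar vPoint)) (ivar vPoint) t9.
pose pre := iset vPoint (ILoad pp (ivar vStep)).
pose mid := IStore d (ivar vPoint) (ivar vAcc).
exists (for_overhead + C1 + C2 + run_cost pre + run_cost mid)%N.
move=> s K n cp cq pq rp sn sK nK t0 sortp sortq wle.
have [rp0 pp1 rp1 _] := sortp.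
have [rq0 pq1 rq1 _] := sortq.
pose X := [:: t; d; vNode; vStep; vPoint; vAcc; vCand].
pose J k s1 := [/\ frame X s s1,
  forall u, (0 < u < 2 ^ K)%N -> heap_eq (rmem s) c (imem s1 t) u,
  forall x, (x < 2 ^ K)%N -> imem s1 t (2 ^ K + x) =
    if (0 < x <= n)%N && (rp (pq x) < k)%N then pq x else 0%N &
  forall u, (1 <= u <= n)%N -> (rp u < k)%N -> best (rmem s) c (fun v =>
      [/\ (1 <= v <= n)%N, (rp v < rp u)%N & (imem s rq v < imem s rq (imem s w u))%N])
      (imem s1 d u)].
apply: within_weaken; first apply: (@within_for _ (run_cost pre + C1 * K.+1 + (run_cost mid + C2
    * K.+1)) n J) => //.
- split=> [|u uK|x xK|u u1n].
  + by apply: frame_set_step; rewrite !inE !orbT.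
  + by rewrite /heap_eq !set_step_neq ?tn // !t0 /better ltxx.
  + rewrite set_step_neq ?tn // t0; case: ifP => // /andP[x1n].
    by have [px1 _] := pq1 x x1n; have [] := rp1 _ px1; lia.
  + by have [] := rp1 u u1n; lia.
- move=> k s1 k1n s1n s1k [fr1 s1h s1l s1d].
  have [i1n rpi] := pp1 k k1n; set i := imem s pp k in i1n rpi.
  have fr1i : forall a j, a \notin X -> imem s1 a j = imem s a j by move=> a j aX; case: fr1 => ->.
  have rm1 : rmem s1 = rmem s by case: fr1.
  have s1rq j : imem s1 rq j = imem s rq j by apply: fr1i; rewrite !inE ?rqn; lia.
  have s1w j : imem s1 w j = imem s w j by apply: fr1i; rewrite !inE ?wn; lia.
  have s1pp j : imem s1 pp j = imem s pp j by apply: fr1i; rewrite !inE ?ppn; lia.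
  have rq_le u : (u <= n)%N -> (imem s rq u <= n)%N.
    by case: u => [|u] un; [rewrite rq0|have [] := rq1 u.+1; lia].
  pose s2 := run pre s1.
  have s2o a j : a != vPoint -> imem s2 a j = imem s1 a j.
    by move=> /negbTE a7; rewrite /s2 /= /update a7.
  have s2i : imem s2 vPoint 0 = i by rewrite /s2 /= /update /= s1k s1pp.
  have s2rm : rmem s2 = rmem s by rewrite -rm1.
  have s2E : run pre s1 = s2 by [].
  clearbody s2.
  apply: within_seq.
  + apply: within_seq; first exact: (within_run (Q := fun s' => s' = s2) _ s2E).
    move=> _ ->; apply: (spec1 s2 K (imem s rq (imem s w i))).
    * by rewrite s2o // fr1i // !inE ?tn; lia.
    * by rewrite /= s2i !s2o ?rqn ?wn // s1rq s1w.
    * by have := rq_le _ (wle i i1n); lia.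
    * by rewrite s2rm => u uK; rewrite /heap_eq !s2o ?tn //; exact: s1h.
  + move=> s3 [fr3]; rewrite s2rm => best3.
    have fr3i a j : a \notin [:: vNode; vAcc; vCand] -> imem s3 a j = imem s2 a j.
      by case: fr3 => fr3 _ aX; exact: fr3.
    have s3i : imem s3 vPoint 0 = i by rewrite fr3i.
    have s3rm : rmem s3 = rmem s by case: fr3 => _ ->.
    pose s4 := run mid s3.
    have s4o a j : a != d -> imem s4 a j = imem s3 a j.
      by move=> /negbTE ad; rewrite /s4 /= /update ad.
    have s4d j : imem s4 d j = if j == i then imem s3 vAcc 0 else imem s1 d j.
      rewrite /s4 /= /update eqxx s3i /=; case: eqP => // _.
      by rewrite fr3i ?s2o ?dn // !inE ?dn.
    have s4t j : imem s4 t j = imem s1 t j.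
      by rewrite s4o // fr3i ?s2o ?tn // !inE ?tn.
    have s4rm : rmem s4 = rmem s by rewrite -s3rm.
    have s4i : imem s4 vPoint 0 = i by rewrite s4o ?dn.
    have s4E : run mid s3 = s4 by [].
    clearbody s4.
    have s4n : imem s4 0 0 = n by rewrite s4o ?fr3i ?s2o //; lia.
    have s4k : imem s4 vStep 0 = k by rewrite s4o ?fr3i ?s2o ?dn.
    apply: within_seq; first exact: (within_run (Q := fun s' => s' = s4) _ s4E).
    move=> _ ->; apply: within_weaken; first apply: (spec2 s4 K (imem s rq i) i).
    * by rewrite s4o ?fr3i ?s2o ?dn // fr1i // !inE ?tn; lia.
    * rewrite /= s4i s4o // fr3i ?s2o ?s1rq ?rqn //; rewrite !inE ?rqn //.
    * by have := rq_le i; lia.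
    * by move=> x; rewrite /= /update /= -/s4 s4i.
    * by rewrite s4rm => u uK; rewrite /heap_eq !s4t; exact: s1h.
    * exact: leqnn.
    move=> s5 [fr5]; rewrite s4rm => s5h s5l.
    have fr5i a j : a \notin [:: t; vNode; vAcc; vCand] -> imem s5 a j = imem s4 a j.
      by case: fr5 => fr5 _ aX; exact: fr5.
    split; [by rewrite fr5i // !inE ?tn; lia|by rewrite fr5i // !inE ?tn; lia|].
    split=> [|u uK|x xK|u u1n].
    * have [_ rm5] := fr5; split=> [a|]; last by rewrite /= rm5 s4rm.
      rewrite !inE => aX j; rewrite set_step_neq; last lia.
      rewrite fr5i; last by rewrite !inE; lia.
      rewrite s4o; last lia.
      rewrite fr3i; last by rewrite !inE; lia.
      rewrite s2o; last lia.
      by apply: fr1i; rewrite !inE; lia.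
    * by rewrite /heap_eq !set_step_neq ?tn //; exact: s5h.
    * rewrite set_step_neq ?tn // s5l // s4t s1l //.
      case: eqP => [->|xi].
        have [rqi pqi] := rq1 i i1n.
        by rewrite pqi rpi ltnSn rqi.
      case: (boolP (0 < x <= n)%N) => //= x1n.
      have [px1 rqx] := pq1 x x1n.
      suff -> : (rp (pq x) < k.+1)%N = (rp (pq x) < k)%N by [].
      have : rp (pq x) <> k.
        move=> rk; apply: xi; rewrite -rqx; congr (imem s rq _).
        have [_ <-] := rp1 _ px1; by rewrite rk.
      lia.
    * rewrite ltnS => ruk; rewrite set_step_neq ?dn // fr5i; last by rewrite !inE ?dn; lia.
      rewrite s4d; case: eqP => [->|ui]; last first.
        apply: s1d => //; have : rp u <> k.
          by move=> rk; apply: ui; have [_ <-] := rp1 u u1n; rewrite rk.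
        lia.
      apply: best_ext best3 => v v0; split=> [[x xlt]|[v1n rv qv]].
        rewrite s2o ?tn //; have x2K : (x < 2 ^ K)%N by have := rq_le _ (wle i i1n); lia.
        rewrite s1l //; case: ifP => [/andP[x1n rk] vE|_ vE]; last by rewrite -vE in v0.
        have [px1 rqx] := pq1 x x1n.
        by subst v; rewrite rqx rpi.
      have [rqv pqv] := rq1 v v1n.
      exists (imem s rq v) => //.
      rewrite s2o ?tn // s1l; last lia.
      by rewrite pqv rqv /= -rpi rv.
- rewrite -/pre -/mid; nia.
by move=> s' [fr _ _ bst]; split=> // u u1n; apply: bst => //; have [] := rp1 u u1n; lia.
Qed.

End Loops.

(** * The tables of nearest points *)

(** The orderings of the three coordinates.  In (p, q, c), an entry of the
    Hessian has its row in coordinate p and its column in coordinate q. *)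
Definition triples : seq (nat * nat * nat) :=
  [:: (0, 1, 2); (0, 2, 1); (1, 0, 2); (1, 2, 0); (2, 0, 1); (2, 1, 0)]%N.

Definition each (X : Type) (f : X -> cmd) (xs : seq X) : cmd :=
  foldr (fun x => Seq (f x)) Skip xs.

Definition row_index (e : iexp) (c : nat) : iexp :=
  ISub (IAdd (IAdd (IAdd e e) e) (IConst c)) (IConst 3).

Definition setup : cmd :=
  Seq (Seq (iset vSize (IConst 1))
           (While (BNot (BLtI (ivar 0) (ivar vSize)))
                  (iset vSize (IAdd (ivar vSize) (ivar vSize)))))
 (Seq (each (fun c => RStore 3 (IConst c) (RLoad 1 (IConst c))) (iota 0 3))
      (for_points
        (Seq (IStore 10 (ivar vStep) (ivar vStep))
             (each (fun c => RStore 3 (IAdd (IAdd (IAdd (ivar vStep) (ivar vStep)) (ivar vStep))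
                 (IConst c))
                                    (RLoad 0 (row_index (ivar vStep) c))) (iota 0 3))))).

(** The other integer arrays.  Array 10 is the identity, so that the first
    sweeps compare every point with itself in both coordinates; the orders and
    ranks are indexed by a coordinate, the table of nearest points by the
    minimised coordinate, and the table of corner ends by the code of a pair of
    coordinates.  Each tree has its own array, which is initially 0, that is,
    empty.  The sorting stage writes to the arrays 11 to 19, the first sweeps to
    the arrays 20 to 25, and the second sweeps to arrays from 30 to 49. *)
Local Notation perm_arr c := (11 + c)%N.
Local Notation rank_arr c := (14 + c)%N.
Local Notation sort_tree c := (17 + c)%N.
Local Notation near_tree c := (20 + c)%N.
Local Notation near_arr c := (23 + c)%N.
Local Notation corner_tree e := (30 + e)%N.
Local Notation corner_arr e := (40 + e)%N.

Definition sort_all : cmd :=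
  each (fun c => sort_points (sort_tree c) (perm_arr c) (rank_arr c) c) (iota 0 3).

(** The table entry for [u] and the minimised coordinate c is the nearest point
    in c among those below [u] in the two other coordinates. *)
Definition first_sweeps : cmd :=
  each (fun x : nat * nat * nat =>
          sweep (near_tree x.2) (perm_arr x.1.1) (rank_arr x.1.2) 10 (near_arr x.2) x.2)
       [:: (1, 2, 0); (0, 2, 1); (0, 1, 2)]%N.

Definition pair_code (x : nat * nat * nat) : nat := (3 * x.1.1 + x.1.2)%N.

(** Given the nearest point d of [u] in coordinate q, finds the point that ends
    the edge at height [u] in p and d in q. *)
Definition second_sweeps : cmd :=
  each (fun x : nat * nat * nat =>
          sweep (corner_tree (pair_code x)) (perm_arr x.1.1) (rank_arr x.1.2) (near_arr x.1.2)
                (corner_arr (pair_code x)) x.2)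
       triples.

Section Stages.
Variable R : realType.
Implicit Types (s : state R).

Lemma frame_imem X s s' a : frame X s s' -> a \notin X -> imem s' a = imem s a.
Proof. by move=> [fr _] aX; apply/funext => k; exact: fr. Qed.

(** [Done x] is what the command of [x] achieves and must survive the commands
    that follow; [Fresh x] is what it needs and must survive those that
    precede. *)
Lemma within_each (X : eqType) (f : X -> cmd) (T : X -> nat) (xs : seq X)
    (Inv : state R -> Prop) (Fresh Done : X -> state R -> Prop) s :
  uniq xs ->
  (forall x s, x \in xs -> Inv s -> Fresh x s -> halts_within (f x) s (T x) (fun s' =>
    [/\ Inv s', Done x s',
        forall y, y \in xs -> y != x -> Done y s -> Done y s' &
        forall y, y \in xs -> y != x -> Fresh y s -> Fresh y s'])) ->
  Inv s -> (forall x, x \in xs -> Fresh x s) ->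
  halts_within (each f xs) s (\sum_(x <- xs) T x) (fun s' =>
    Inv s' /\ forall x, x \in xs -> Done x s').
Proof.
move=> xs_uniq step.
suff gen l pre s1 : xs = pre ++ l -> Inv s1 -> (forall x, x \in pre -> Done x s1) ->
    (forall x, x \in l -> Fresh x s1) ->
    halts_within (each f l) s1 (\sum_(x <- l) T x) (fun s' => Inv s' /\ forall x,
        x \in xs -> Done x s').
  by move=> Is fresh; apply: (gen xs [::]).
elim: l pre s1 => [|x l ih] pre s1 xsE I1 done fresh.
  rewrite big_nil; apply: (within_weaken (T := 0%N)) => //.
    by apply: (within_run (c := Skip) (Q := fun s' => s' = s1)).
  by move=> _ ->; split=> // y; rewrite xsE cats0; exact: done.
have xin : x \in xs by rewrite xsE mem_cat mem_head orbT.
rewrite big_cons /=; apply: within_seq; first by apply: step => //; apply: fresh; exact: mem_head.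
move=> s2 [I2 d2 keep_done keep_fresh].
have xl : x \notin l /\ x \notin pre.
  move: xs_uniq; rewrite xsE cat_uniq /= negb_or => /and3P[_ /andP[xpre _] /andP[xl _]].
  by split.
apply: (ih (rcons pre x)) => //; first by rewrite cat_rcons.
- move=> y; rewrite mem_rcons in_cons => /orP[/eqP -> //|ypre].
  apply: keep_done; [by rewrite xsE mem_cat ypre| |exact: done].
  by apply: contraNneq (proj2 xl) => <-.
- move=> y yl; apply: keep_fresh; [by rewrite xsE mem_cat in_cons yl !orbT| |].
    by apply: contraNneq (proj1 xl) => <-.
  by apply: fresh; rewrite in_cons yl orbT.
Qed.

Definition distinct_keys (k : nat -> nat -> R) (n : nat) : Prop :=
  (forall u c, (c < 3)%N -> (1 <= u <= n)%N -> k u c < k 0%N c) /\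
  (forall u w c, (c < 3)%N -> (1 <= u <= n)%N -> (1 <= w <= n)%N -> u <> w ->
     k u c <> k w c).

Definition scratch : seq nat := [:: vNode; vStep; vPoint; vAcc; vCand].

Lemma sort_all_spec : exists C : nat, forall s (K n : nat),
  imem s 0 0 = n -> imem s vSize 0 = (2 ^ K)%N -> (n < 2 ^ K)%N ->
  (forall a k, (10 < a)%N -> imem s a k = 0%N) -> distinct_keys (mkey (rmem s)) n ->
  halts_within sort_all s (C * (n.+1 * K.+1)) (fun s' =>
    frame (scratch ++ iota 11 9) s s' /\
    forall c, (c < 3)%N ->
      sorted_by (rmem s) n c (imem s' (perm_arr c)) (imem s' (rank_arr c))).
Proof.
have spec c : exists C : nat, forall s (K n : nat),
  imem s 0 0 = n -> imem s vSize 0 = (2 ^ K)%N -> (n < 2 ^ K)%N ->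
  (forall k, imem s (sort_tree c) k = 0%N) -> (forall k, imem s (rank_arr c) k = 0%N) ->
  (forall u, (1 <= u <= n)%N -> mkey (rmem s) u c < mkey (rmem s) 0 c) ->
  (forall u w, (1 <= u <= n)%N -> (1 <= w <= n)%N -> u <> w ->
     mkey (rmem s) u c <> mkey (rmem s) w c) ->
  halts_within (sort_points (sort_tree c) (perm_arr c) (rank_arr c) c) s (C * (n.+1 * K.+1)) (fun
      s' =>
    frame [:: sort_tree c; perm_arr c; rank_arr c; vNode; vStep; vPoint; vAcc; vCand]%N s s' /\
    sorted_by (rmem s) n c (imem s' (perm_arr c)) (imem s' (rank_arr c))).
  by apply: sort_spec; rewrite /= ?inE; lia.
have [C {}spec] := choice spec.
exists (\sum_(c <- iota 0 3) C c)%N => s K n sn sK nK zero [kref kinj].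
pose Inv s1 := frame (scratch ++ iota 11 9) s s1.
pose Fresh c s1 := (forall k, imem s1 (sort_tree c) k = 0%N) /\ (forall k,
    imem s1 (rank_arr c) k = 0%N).
pose Done c s1 := sorted_by (rmem s) n c (imem s1 (perm_arr c)) (imem s1 (rank_arr c)).
apply: within_weaken; first apply: (@within_each _ _ (fun c =>
    C c * (n.+1 * K.+1))%N _ Inv Fresh Done).
- exact: iota_uniq.
- move=> c s1; rewrite mem_iota => c3 I1 [t0 r0].
  have rm : rmem s1 = rmem s by case: I1.
  apply: within_weaken; first apply: (spec c s1 K n) => //.
  + by rewrite (frame_imem I1) // mem_cat mem_iota !inE.
  + by rewrite (frame_imem I1) // mem_cat mem_iota !inE.
  + by rewrite rm => u; apply: kref; lia.
  + by rewrite rm => u w; apply: kinj; lia.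
  + exact: leqnn.
  + move=> s2 [fr srt]; split.
    * apply: (frame_trans I1); apply: frame_sub fr => a.
      by rewrite mem_cat mem_iota !inE; lia.
    * by rewrite /Done -rm.
    * move=> y; rewrite mem_iota => y3 yc; rewrite /Done.
      by rewrite !(frame_imem fr) // !inE; lia.
    * move=> y; rewrite mem_iota => y3 yc; rewrite /Fresh.
      by rewrite !(frame_imem fr) // !inE; lia.
- by [].
- by move=> c _; split=> k; apply: zero; lia.
- by rewrite big_distrl.
by move=> s' [fr dn]; split=> // c c3; apply: dn; rewrite mem_iota.
Qed.

(** The answer to a query: [d] is the end of the edge in direction [c] at height
    [u] in [p] and [v] in [q]. *)
Definition corner_min m n (u v p q c : nat) (d : nat) : Prop :=
  @best R m c (fun w => [/\ (1 <= w <= n)%N, mkey m w p < mkey m u p &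
    mkey m w q < mkey m v q]) d.

(** Ranks reflect the order of the coordinates, hence the answers of a sweep can
    be expressed without ranks. *)
Lemma sweep_corner_min t p q w d c : (p < 3)%N -> (q < 3)%N -> (c < 3)%N ->
  all (fun a => (19 < a)%N) [:: t; d] -> (9 < w)%N ->
  uniq [:: t; d; w] -> exists C : nat, forall s (K n : nat),
  imem s 0 0 = n -> imem s vSize 0 = (2 ^ K)%N -> (n < 2 ^ K)%N ->
  distinct_keys (mkey (rmem s)) n ->
  (forall c, (c < 3)%N -> sorted_by (rmem s) n c (imem s (perm_arr c)) (imem s (rank_arr c))) ->
  (forall k, imem s t k = 0%N) ->
  (forall u, (1 <= u <= n)%N -> (imem s w u <= n)%N) ->
  halts_within (sweep t (perm_arr p) (rank_arr q) w d c) s (C * (n.+1 * K.+1)) (fun s' =>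
    frame [:: t; d; vNode; vStep; vPoint; vAcc; vCand] s s' /\
    forall u, (1 <= u <= n)%N -> imem s w u <> 0%N ->
      corner_min (rmem s) n u (imem s w u) p q c (imem s' d u)).
Proof.
move=> p3 q3 c3 /and3P[t19 d19 _] w9; rewrite /= !inE negb_or => /and3P[/andP[td tw] dw _].
have [||||C spec] := @sweep_spec R t (perm_arr p) (rank_arr q) w d c; try lia.
  by rewrite /=; lia.
exists C => s K n sn sK nK [_ kinj] srt t0 wle.
apply: within_weaken; first apply: (spec s K n p q (imem s (perm_arr q)) (imem s (rank_arr p)))
    => //.
- exact: srt.
- exact: srt.
- exact: leqnn.
move=> s' [fr bst]; split=> // u u1n wu.
have w1n : (1 <= imem s w u <= n)%N by have := wle u u1n; lia.
have cmp a : (a < 3)%N -> forall x y, (1 <= x <= n)%N -> (1 <= y <= n)%N ->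
    (imem s (rank_arr a) x < imem s (rank_arr a) y)%N = (mkey (rmem s) x a < mkey (rmem s) y a).
  move=> a3 x y x1 y1; apply: (sorted_lt (srt a a3)) => // z1 z2 z1n z2n.
  exact: kinj.
apply: best_ext (bst u u1n) => v _; split=> -[v1n].
  by rewrite !cmp.
by move=> vp vq; split=> //; rewrite cmp.
Qed.

Lemma first_sweeps_spec : exists C : nat, forall s (K n : nat),
  imem s 0 0 = n -> imem s vSize 0 = (2 ^ K)%N -> (n < 2 ^ K)%N ->
  distinct_keys (mkey (rmem s)) n ->
  (forall c, (c < 3)%N -> sorted_by (rmem s) n c (imem s (perm_arr c)) (imem s (rank_arr c))) ->
  (forall a k, (19 < a)%N -> imem s a k = 0%N) ->
  (forall u, (1 <= u <= n)%N -> imem s 10 u = u) ->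
  halts_within first_sweeps s (C * (n.+1 * K.+1)) (fun s' =>
    frame (scratch ++ iota 20 6) s s' /\
    forall x, x \in [:: (1, 2, 0); (0, 2, 1); (0, 1, 2)]%N ->
      forall u, (1 <= u <= n)%N ->
      corner_min (rmem s) n u u x.1.1 x.1.2 x.2 (imem s' (near_arr x.2) u)).
Proof.
have spec (x : nat * nat * nat) : exists C : nat, x \in [:: (1, 2, 0); (0, 2, 1); (0, 1, 2)]%N ->
    forall s (K n : nat),
  imem s 0 0 = n -> imem s vSize 0 = (2 ^ K)%N -> (n < 2 ^ K)%N ->
  distinct_keys (mkey (rmem s)) n ->
  (forall c, (c < 3)%N -> sorted_by (rmem s) n c (imem s (perm_arr c)) (imem s (rank_arr c))) ->
  (forall k, imem s (near_tree x.2) k = 0%N) ->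
  (forall u, (1 <= u <= n)%N -> (imem s 10 u <= n)%N) ->
  halts_within (sweep (near_tree x.2) (perm_arr x.1.1) (rank_arr x.1.2) 10 (near_arr x.2) x.2) s
      (C * (n.+1 * K.+1)) (fun s' =>
    frame [:: near_tree x.2; near_arr x.2; vNode; vStep; vPoint; vAcc; vCand]%N s s' /\
    forall u, (1 <= u <= n)%N -> imem s 10 u <> 0%N ->
      corner_min (rmem s) n u (imem s 10 u) x.1.1 x.1.2 x.2 (imem s' (near_arr x.2) u)).
  have [xin|_] := boolP (x \in _); last by exists 0%N.
  have [C spec] : exists C : nat, _ := @sweep_corner_min (near_tree x.2) x.1.1 x.1.2 10 (near_arr
      x.2) x.2
    ltac:(by move: xin; rewrite !inE => /or3P[]/eqP ->) ltac:(by move: xin;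
        rewrite !inE => /or3P[]/eqP ->)
    ltac:(by move: xin; rewrite !inE => /or3P[]/eqP ->) ltac:(by rewrite /=; lia) isT
    ltac:(by rewrite /= !inE; lia).
  by exists C.
have [C {}spec] := choice spec.
set xs := [:: (1, 2, 0); (0, 2, 1); (0, 1, 2)]%N in spec *.
exists (\sum_(x <- xs) C x)%N => s K n sn sK nK keys srt zero ident.
pose Inv s1 := frame (scratch ++ iota 20 6) s s1.
pose Fresh (x : nat * nat * nat) s1 := forall k, imem s1 (near_tree x.2) k = 0%N.
pose Done (x : nat * nat * nat) s1 := forall u, (1 <= u <= n)%N ->
  corner_min (rmem s) n u u x.1.1 x.1.2 x.2 (imem s1 (near_arr x.2) u).
have x3 x : x \in xs -> (x.2 < 3)%N by rewrite !inE => /or3P[]/eqP ->.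
have xneq x y : x \in xs -> y \in xs -> y != x -> y.2 <> x.2.
  by rewrite !inE => /or3P[]/eqP -> /or3P[]/eqP ->.
apply: within_weaken; first apply: (@within_each _ _ (fun x =>
    C x * (n.+1 * K.+1))%N xs Inv Fresh Done).
- by [].
- move=> x s1 xin I1 t0.
  have rm : rmem s1 = rmem s by case: I1.
  have id1 : imem s1 10 = imem s 10 by rewrite (frame_imem I1) // mem_cat mem_iota !inE.
  apply: within_weaken; first apply: (spec x xin s1 K n) => //.
  + by rewrite (frame_imem I1) // mem_cat mem_iota !inE.
  + by rewrite (frame_imem I1) // mem_cat mem_iota !inE.
  + by rewrite rm.
  + by move=> c c3; rewrite rm !(frame_imem I1) ?mem_cat ?mem_iota ?inE; [exact: srt|lia|lia].
  + by move=> u u1n; rewrite id1 ident //; lia.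
  + exact: leqnn.
  + have := x3 x xin => x23; rewrite rm id1 => s2 [fr dn]; split.
    * apply: (frame_trans I1); apply: frame_sub fr => a.
      by rewrite mem_cat mem_iota !inE; move: (x.2) x23 => c2 c23; lia.
    * by move=> u u1n; have := dn u u1n; rewrite ident // => dnu; apply: dnu; lia.
    * move=> y yin yx dy u u1n; rewrite (frame_imem fr); first exact: dy.
      move: (xneq x y xin yin yx) (x3 y yin) (x3 x xin); rewrite !inE.
      by move: (x.2) (y.2) => *; lia.
    * move=> y yin yx fy k; rewrite (frame_imem fr); first exact: fy.
      move: (xneq x y xin yin yx) (x3 y yin) (x3 x xin); rewrite !inE.
      by move: (x.2) (y.2) => *; lia.
- by [].
- by move=> x _ k; apply: zero; lia.
- by rewrite big_distrl.
by move=> s' [fr dn]; split=> // x xin; exact: dn.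
Qed.

Lemma second_sweeps_spec : exists C : nat, forall s (K n : nat),
  imem s 0 0 = n -> imem s vSize 0 = (2 ^ K)%N -> (n < 2 ^ K)%N ->
  distinct_keys (mkey (rmem s)) n ->
  (forall c, (c < 3)%N -> sorted_by (rmem s) n c (imem s (perm_arr c)) (imem s (rank_arr c))) ->
  (forall a k, (29 < a)%N -> imem s a k = 0%N) ->
  (forall c u, (c < 3)%N -> (1 <= u <= n)%N -> (imem s (near_arr c) u <= n)%N) ->
  halts_within second_sweeps s (C * (n.+1 * K.+1)) (fun s' =>
    frame (scratch ++ iota 30 20) s s' /\
    forall x, x \in triples ->
      forall u, (1 <= u <= n)%N -> imem s (near_arr x.1.2) u <> 0%N ->
      corner_min (rmem s) n u (imem s (near_arr x.1.2) u) x.1.1 x.1.2 x.2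
        (imem s' (corner_arr (pair_code x)) u)).
Proof.
have spec (x : nat * nat * nat) : exists C : nat, x \in triples ->
    forall s (K n : nat),
  imem s 0 0 = n -> imem s vSize 0 = (2 ^ K)%N -> (n < 2 ^ K)%N ->
  distinct_keys (mkey (rmem s)) n ->
  (forall c, (c < 3)%N -> sorted_by (rmem s) n c (imem s (perm_arr c)) (imem s (rank_arr c))) ->
  (forall k, imem s (corner_tree (pair_code x)) k = 0%N) ->
  (forall u, (1 <= u <= n)%N -> (imem s (near_arr x.1.2) u <= n)%N) ->
  halts_within (sweep (corner_tree (pair_code x)) (perm_arr x.1.1) (rank_arr x.1.2) (near_arr
      x.1.2) (corner_arr (pair_code x)) x.2) s
    (C * (n.+1 * K.+1)) (fun s' =>
    frame [:: corner_tree (pair_code x); corner_arr (pair_code x); vNode; vStep; vPoint; vAcc;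
        vCand]%N s s' /\
    forall u, (1 <= u <= n)%N -> imem s (near_arr x.1.2) u <> 0%N ->
      corner_min (rmem s) n u (imem s (near_arr x.1.2) u) x.1.1 x.1.2 x.2 (imem s' (corner_arr
          (pair_code x)) u)).
  have [xin|_] := boolP (x \in _); last by exists 0%N.
  have [p3 q3 c3] : [/\ (x.1.1 < 3)%N, (x.1.2 < 3)%N & (x.2 < 3)%N].
    by move: xin; rewrite !inE; do 5?[case/orP=> [/eqP -> //|]]; move/eqP ->.
  have [C spec] : exists C : nat, _ := @sweep_corner_min (corner_tree (pair_code x)) x.1.1 x.1.2
    (near_arr x.1.2) (corner_arr (pair_code x)) x.2 p3 q3 c3 ltac:(by rewrite /=; lia) ltac:(lia)
    ltac:(by rewrite /= !inE /pair_code; lia).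
  by exists C.
have [C {}spec] := choice spec.
exists (\sum_(x <- triples) C x)%N => s K n sn sK nK keys srt zero wle.
pose Inv s1 := frame (scratch ++ iota 30 20) s s1.
pose Fresh (x : nat * nat * nat) s1 := forall k, imem s1 (corner_tree (pair_code x)) k = 0%N.
pose Done (x : nat * nat * nat) s1 := forall u, (1 <= u <= n)%N -> imem s (near_arr x.1.2) u <>
    0%N ->
  corner_min (rmem s) n u (imem s (near_arr x.1.2) u) x.1.1 x.1.2 x.2 (imem s1 (corner_arr
      (pair_code x)) u).
have x3 x : x \in triples -> (pair_code x < 9)%N /\ (x.1.2 < 3)%N.
  by rewrite !inE; do 5?[case/orP=> [/eqP -> //|]]; move/eqP ->.
have xneq x y : x \in triples -> y \in triples -> y != x -> pair_code y <> pair_code x.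
  move=> xin yin yx; suff /allP/(_ x xin)/allP/(_ y yin)/implyP/(_ yx)/eqP : all (fun x =>
    all (fun y => (y != x) ==> (pair_code y != pair_code x)) triples) triples by [].
  by [].
apply: within_weaken; first apply: (@within_each _ _ (fun x =>
    C x * (n.+1 * K.+1))%N triples Inv Fresh Done).
- by [].
- move=> x s1 xin I1 t0.
  have rm : rmem s1 = rmem s by case: I1.
  have [x23 xq3] := x3 x xin.
  have w1 : imem s1 (near_arr x.1.2) = imem s (near_arr x.1.2).
    by rewrite (frame_imem I1) // mem_cat mem_iota !inE; lia.
  apply: within_weaken; first apply: (spec x xin s1 K n) => //.
  + by rewrite (frame_imem I1) // mem_cat mem_iota !inE.
  + by rewrite (frame_imem I1) // mem_cat mem_iota !inE.
  + by rewrite rm.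
  + by move=> c c3; rewrite rm !(frame_imem I1) ?mem_cat ?mem_iota ?inE; [exact: srt|lia|lia].
  + by move=> u u1n; rewrite w1; apply: wle.
  + exact: leqnn.
  + rewrite rm w1 => s2 [fr dn]; split.
    * apply: (frame_trans I1); apply: frame_sub fr => a.
      by rewrite mem_cat mem_iota !inE; lia.
    * by [].
    * move=> y yin yx dy u u1n; rewrite (frame_imem fr); first exact: dy.
      move: (xneq x y xin yin yx) (x3 y yin) (x3 x xin) => ? [? _] [? _]; rewrite !inE; lia.
    * move=> y yin yx fy k; rewrite (frame_imem fr); first exact: fy.
      move: (xneq x y xin yin yx) (x3 y yin) (x3 x xin) => ? [? _] [? _]; rewrite !inE; lia.
- by [].
- by move=> x _ k; apply: zero; lia.
- by rewrite big_distrl.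
by move=> s' [fr dn]; split=> // x xin; exact: dn.
Qed.

End Stages.

(** * Writing the list of entries *)

(** The coordinates as the program numbers the points, 0 being the reference
    point. *)
Definition key (R : realType) n (x : hv_instance R n) (u c : nat) : R :=
  if u is u'.+1 then read_row (points x) (3 * u' + c) else read_row (refpoint x) c.

Definition emit (a b : iexp) (v : rexp) : cmd :=
  Seq (IStore 1 (ivar 3) a)
 (Seq (IStore 2 (ivar 3) b)
 (Seq (RStore 2 (ivar 3) v)
      (iset 3 (IAdd (ivar 3) (IConst 1))))).

(** An item of the output has a kind: 0 for the entries (u, p; u, q), 1 for the
    entry of u and its nearest point d in coordinate q, in row (u, p) and column
    (d, q), and 2 for the transposed entry. *)
Definition kinds : seq (nat * (nat * nat * nat)) := [seq (i, x) | i <- iota 0 3, x <- triples].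

Definition emit_entry (z : nat * (nat * nat * nat)) : cmd :=
  let: (kind, (p, q, c)) := z in
  let u := ivar vStep in
  let d := ILoad (near_arr q) u in
  let v := ROp Rsub (rkey u c) (rkey (ILoad (corner_arr (pair_code (p, q, c))) u) c) in
  match kind with
  | 0 => emit (row_index u p) (row_index u q)
              (ROp Rsub (rkey (ILoad (near_arr c) u) c) (rkey u c))
  | 1 => If (BLtI (IConst 0) d) (emit (row_index u p) (row_index d q) v) Skip
  | _ => If (BLtI (IConst 0) d) (emit (row_index d q) (row_index u p) v) Skip
  end.

Definition write_entries : cmd := for_points (each emit_entry kinds).

Section Output.
Variable R : realType.
Implicit Types (s : state R).

Definition row (u c : nat) : nat := (u + u + u + c - 3)%N.

Definition listed (D : nat -> nat -> nat) (y : nat * (nat * (nat * nat * nat))) : bool :=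
  let: (u, (kind, (p, q, c))) := y in
  match kind with 0 => true | _ => (0 < D q u)%N end.

Definition entry (k : nat -> nat -> R) (D E : nat -> nat -> nat)
    (y : nat * (nat * (nat * nat * nat))) : nat * nat * R :=
  let: (u, (kind, (p, q, c))) := y in
  let v := k u c - k (E (pair_code (p, q, c)) u) c in
  match kind with
  | 0 => (row u p, row u q, k (D c u) c - k u c)
  | 1 => (row u p, row (D q u) q, v)
  | _ => (row (D q u) q, row u p, v)
  end.

Lemma output_rcons s s' i j v : imem s' 3 0 = (imem s 3 0).+1 ->
  (forall k, imem s' 1 k = if k == imem s 3 0 then i else imem s 1 k) ->
  (forall k, imem s' 2 k = if k == imem s 3 0 then j else imem s 2 k) ->
  (forall k, rmem s' 2 k = if k == imem s 3 0 then v else rmem s 2 k) ->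
  output s' = output s ++ [:: (i, j, v)].
Proof.
move=> s3 s1 s2 r2; rewrite /output s3 -[(imem s 3 0).+1]addn1 iotaD map_cat /= add0n s1 s2 r2 eqxx.
congr (_ ++ _); apply/eq_in_map => k; rewrite mem_iota => k_lt.
by rewrite s1 s2 r2; have -> : (k == imem s 3 0) = false by lia.
Qed.

Lemma run_if b c1 c2 s :
  run (If b c1 c2) s = if beval s b then run c1 s else run c2 s.
Proof. by []. Qed.

Lemma run_emit_entry s z : z \in kinds ->
  let k := mkey (rmem s) in let D c := imem s (near_arr c) in let E c := imem s (corner_arr c) in
  let y := (imem s vStep 0, z) in let s' := run (emit_entry z) s in
  [/\ output s' = output s ++ (if listed D y then [:: entry k D E y] else [::]),
      (forall a, (3 < a)%N -> imem s' a = imem s a) /\ imem s' 0 = imem s 0 &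
      forall a, a <> 2%N -> rmem s' a = rmem s a].
Proof.
case: z => kind [[p q] c] zin k D E y s'.
have emitE a b v :
    let s1 := State (update (imem s) 1 (imem s 3 0) (ieval s a)) (rmem s) in
    let s2 := State (update (imem s1) 2 (imem s 3 0) (ieval s1 b)) (rmem s) in
    let s' := run (emit a b v) s in
    [/\ output s' = output s ++ [:: (ieval s a, ieval s1 b, reval s2 v)],
      (forall a, (3 < a)%N -> imem s' a = imem s a) /\ imem s' 0 = imem s 0 &
      forall a, a <> 2%N -> rmem s' a = rmem s a].
  move=> s1 s2 s3; split.
  - by apply: output_rcons; rewrite /= /update /= ?addn1 // => j; rewrite andbT.
  - split=> [a' a3|]; last by rewrite /= /update /=.
    apply/funext => j; rewrite /= /update /=.
    by rewrite !ifN //; apply/negP => /andP[/eqP]; lia.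
  - by move=> a' /eqP a2; apply/funext => j; rewrite /= /update (negbTE a2).
rewrite /s' /y /emit_entry /listed /entry {s' y}; case: kind zin => [|[|kind]] _.
- exact: emitE.
- rewrite run_if [beval _ _]/=; case: ifP => _; first exact: emitE.
  by split; rewrite ?cats0.
- rewrite run_if [beval _ _]/=; case: ifP => _; first exact: emitE.
  by split; rewrite ?cats0.
Qed.

Lemma output_ext s s' : imem s' 3 = imem s 3 -> imem s' 1 = imem s 1 ->
  imem s' 2 = imem s 2 -> rmem s' 2 = rmem s 2 -> output s' = output s.
Proof. by move=> e3 e1 e2 er; rewrite /output e3; apply/eq_map => k; rewrite e1 e2 er. Qed.

Lemma run_emit_entries s zs : {subset zs <= kinds} ->
  let k := mkey (rmem s) in let D c := imem s (near_arr c) in let E c := imem s (corner_arr c) in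
  let u := imem s vStep 0 in let s' := run (each emit_entry zs) s in
  [/\ output s' = output s ++ flatten [seq if listed D (u, z) then [:: entry k D E (u,
      z)] else [::] | z <- zs],
      (forall a, (3 < a)%N -> imem s' a = imem s a) /\ imem s' 0 = imem s 0 &
      forall a, a <> 2%N -> rmem s' a = rmem s a].
Proof.
elim: zs s => [|z zs ih] s zin k D E u s'; first by split=> //=; rewrite cats0.
have [] := @run_emit_entry s z; first by apply: zin; exact: mem_head.
set s1 := run (emit_entry z) s => out1 [im1 im10] rm1.
have [] := ih s1; first by move=> y yin; apply: zin; rewrite in_cons yin orbT.
have -> : mkey (rmem s1) = mkey (rmem s) by apply/funext => v; apply/funext => c; rewrite /mkey rm1.
rewrite im1 // -/u.
have -> : (fun c => imem s1 (near_arr c)) = D by apply/funext => c; rewrite im1 //; lia.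
have -> : (fun c => imem s1 (corner_arr c)) = E by apply/funext => c; rewrite im1 //; lia.
move=> out2 [im2 im20] rm2; split.
- by rewrite /s' /= -/s1 out2 out1 catA.
- by split=> [a a3|]; [rewrite /s' /= im2 // im1|rewrite /s' /= im20 im10].
- by move=> a a2; rewrite /s' /= rm2 // rm1.
Qed.

Definition all_entries (k : nat -> nat -> R) (D E : nat -> nat -> nat) (n : nat) : seq (nat * nat
    * R) :=
  [seq entry k D E y | y <- [seq (u, z) | u <- iota 1 n, z <- kinds] & listed D y].

Lemma loop_free_each (X : Type) (f : X -> cmd) xs :
  (forall x, loop_free (f x)) -> loop_free (each f xs).
Proof. by move=> lf; elim: xs => //= x xs ->; rewrite lf. Qed.

Lemma write_entries_spec : exists C : nat, forall s n,
  imem s 0 0 = n -> imem s 3 0 = 0%N ->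
  halts_within write_entries s (C * n.+1) (fun s' =>
    output s' = all_entries (mkey (rmem s)) (fun c => imem s (near_arr c))
      (fun c => imem s (corner_arr c)) n).
Proof.
exists (for_overhead + run_cost (each emit_entry kinds))%N => s n sn s30.
set k := mkey (rmem s); set D := fun c => imem s (near_arr c);
    set E := fun c => imem s (corner_arr c).
pose J j s1 := [/\ output s1 = flatten [seq flatten
     [seq if listed D (u, z) then [:: entry k D E (u,
         z)] else [::] | z <- kinds] | u <- iota 1 j.-1],
  (forall a, (6 < a)%N -> imem s1 a = imem s a) /\ imem s1 0 = imem s 0 &
  rmem s1 3 = rmem s 3].
have step_imem s1 j a : a <> 6%N -> imem (set_step s1 j) a = imem s1 a.
  by move=> /eqP a6; apply/funext => i; rewrite set_step_neq.
apply: (within_weaken (Q := J n.+1)); first apply: within_for => //.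
- split; first by rewrite /output set_step_neq // s30.
    by split=> [a a6|]; rewrite step_imem //; lia.
  by [].
- move=> j s1 j1n s1n s1j [out [im im0] rm].
  apply: within_run.
    by apply: loop_free_each => -[[|[|i]] [[p q] c]].
  have [] := @run_emit_entries s1 kinds; first by [].
  have -> : mkey (rmem s1) = k by apply/funext => v; apply/funext => c; rewrite /mkey rm.
  have -> : (fun c => imem s1 (near_arr c)) = D by apply/funext => c; rewrite im //; lia.
  have -> : (fun c => imem s1 (corner_arr c)) = E by apply/funext => c; rewrite im //; lia.
  move: (run _ _) => s2 out2 [im2 im20] rm2.
  have step2 a : a <> 6%N -> imem (set_step s2 j.+1) a = imem s2 a by exact: step_imem.
  split; [by rewrite im20|by rewrite im2|split].
  + rewrite (@output_ext s2) ?step2 // out2 out s1j.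
    have -> : iota 1 j.+1.-1 = iota 1 j.-1 ++ [:: j].
      by case: (j) j1n => // i _; rewrite -[i.+1 in LHS]addn1 iotaD add1n.
    rewrite map_cat flatten_cat; congr (_ ++ _).
    exact: (esym (cats0 _)).
  + split=> [a a6|]; last by rewrite step2 // im20 im0.
    by rewrite step2 ?im2 ?im //; lia.
  + by rewrite /= rm2.
- exact: leqnn.
move=> s' [-> _ _]; rewrite /all_entries [n.+1.-1]/=.
move: kinds => zs; elim: (iota 1 n) => //= u us ih.
rewrite filter_cat map_cat -ih; congr (_ ++ _).
by elim: zs {ih} => //= z zs' ->; case: ifP.
Qed.

End Output.

(** * The whole program *)

Definition hessian_program : cmd :=
  Seq setup (Seq sort_all (Seq first_sweeps (Seq second_sweeps write_entries))).

Section Program.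
Variable R : realType.
Implicit Types (s : state R).

(** The tree size is the first power of two above n, hence less than 2 n + 2,
    which bounds the depth of the trees. *)
Lemma setup_spec : exists C : nat, forall n (x : hv_instance R n),
  halts_within setup (hv_encode x) (C * n.+1) (fun s => exists K,
    [/\ (n < 2 ^ K <= 2 * n.+1)%N,
        imem s 0 0 = n /\ imem s vSize 0 = (2 ^ K)%N,
        forall u, (1 <= u <= n)%N -> imem s 10 u = u,
        (forall a k, (10 < a)%N -> imem s a k = 0%N) /\ imem s 3 0 = 0%N &
        forall u c, (u <= n)%N -> (c < 3)%N -> mkey (rmem s) u c = key x u c]).
Proof.
pose double := iset vSize (IAdd (ivar vSize) (ivar vSize)).
pose test := BNot (BLtI (ivar 0) (ivar vSize)).
pose copy_ref := each (fun c => RStore 3 (IConst c) (RLoad 1 (IConst c))) (iota 0 3).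
pose copy := Seq (IStore 10 (ivar vStep) (ivar vStep))
  (each (fun c => RStore 3 (IAdd (IAdd (IAdd (ivar vStep) (ivar vStep)) (ivar vStep)) (IConst c))
                                    (RLoad 0 (row_index (ivar vStep) c))) (iota 0 3)).
exists (run_cost (iset vSize (IConst 1)) + bcost AllOps test + (bcost AllOps test + run_cost double)
  + run_cost copy_ref + for_overhead + run_cost copy)%N => n x.
set s0 := hv_encode x.
have s0n : imem s0 0 0 = n by [].
pose I j s1 := exists K, [/\ (2 ^ K + j = n.+1)%N \/ (n < 2 ^ K)%N, (2 ^ K <= 2 * n.+1)%N,
  imem s1 vSize 0 = (2 ^ K)%N, forall a, a <> vSize -> imem s1 a = imem s0 a & rmem s1 = rmem s0].
pose J k s1 := [/\ exists K, (n < 2 ^ K <= 2 * n.+1)%N /\ imem s1 vSize 0 = (2 ^ K)%N,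
   forall a, a <> vSize -> a <> vStep -> a <> 10%N -> imem s1 a = imem s0 a,
   forall u, (1 <= u < k)%N -> imem s1 10 u = u,
   rmem s1 0 = rmem s0 0 &
   forall u c, (u < k)%N -> (c < 3)%N -> mkey (rmem s1) u c = key x u c].
apply: (within_weaken (Q := J n.+1)); first apply: within_seq.
- apply: within_seq.
  + apply: (within_run (Q := I n)) => //.
    exists 0%N; split=> //; first by left; rewrite expn0; lia.
    by move=> a /eqP/negbTE a4; apply/funext => k; rewrite /= /update a4.
  + move=> s1; apply: (within_while (T := run_cost double)) => j {}s1 [K [hK K2 sK im rm]].
    rewrite /= -leqNgt sK im // s0n => nK.
    have K0 : (0 < 2 ^ K)%N by rewrite expn_gt0.
    apply: within_run => //; case: hK => hK; last by lia.
    have [jK|jK] := leqP (2 ^ K) j.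
      exists (j - 2 ^ K)%N; first by lia.
      exists K.+1; rewrite expnS; split=> //.
      - by left; lia.
      - by lia.
      - by rewrite /= /update /= sK; lia.
      - by move=> a a4; rewrite -im //; move/eqP/negbTE: a4 => a4; apply/funext => k;
          rewrite /= /update a4.
    exists 0%N; first by lia.
    exists K.+1; rewrite expnS; split=> //.
    - by right; lia.
    - by lia.
    - by rewrite /= /update /= sK; lia.
    - by move=> a a4; rewrite -im //; move/eqP/negbTE: a4 => a4; apply/funext => k;
        rewrite /= /update a4.
- move=> s1 [[j [K [_ K2 sK im rm]]] /=]; rewrite negbK sK im // s0n => nK.
  apply: within_seq.
  + apply: (within_run (Q := fun s' => s' = run copy_ref s1)) => //.
  move=> _ ->; apply: (@within_for _ _ (run_cost copy) n J).
  + by rewrite /= im.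
  + split=> //.
    * by exists K; rewrite K2 andbT.
    * move=> a a4 a6 _; rewrite -im //; move/eqP/negbTE: a6 => a6.
      by apply/funext => k; rewrite /= /update a6.
    * by move=> u; lia.
    * by rewrite /= rm.
    * move=> u c; rewrite ltnS leqn0 => /eqP -> c3.
      by rewrite /mkey /= !rm /=; case: c c3 => [|[|[|]]].
  + move=> k s2 k1n s2n s2k [s2K s2im s2id s2r s2key]; apply: within_run => //; split=> //.
    split.
    * exact: s2K.
    * move=> a a4 a6 a10; rewrite -s2im //; move/eqP/negbTE: a6 => a6; move/eqP/negbTE: a10 => a10.
      by apply/funext => i; rewrite /= /update /= a6 a10.
    * move=> u uk; rewrite /= /update /= s2k.
      by case: eqP => [//|uk']; apply: s2id; lia.
    * by rewrite -s2r; apply/funext => i; rewrite /= /update /=.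
    * move=> u c uk c3; rewrite /mkey /= /update /= s2k !s2r.
      have rd i : (i < 3)%N -> rmem s0 0 (k + k + k + i - 3) = key x k i.
        by case: (k) k1n => // k' _ i3 /=; congr read_row; lia.
      have [->|uk'] := eqVneq u k.
        case: c c3 => [|[|[|//]]] _; rewrite !eqn_add2l /=; exact: rd.
      have neq i : (i < 3)%N -> (u + u + u + c == k + k + k + i)%N = false by lia.
      rewrite !neq //; apply: s2key => //; lia.
- rewrite [X in (_ + (X + _) <= _)%N](_ : _ = run_cost copy_ref) // -/double -/test.
  nia.
move=> s' [[K [nK sK]] im id r ky]; exists K; split=> //.
- by rewrite im.
- by split=> [a k a10|]; rewrite im //=; try lia; case: a a10.
Qed.

Lemma hessian_program_spec : exists C : nat, forall n (x : hv_instance R n),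
  distinct_keys (key x) n ->
  halts_within hessian_program (hv_encode x) (C * (n.+1 * (trunc_log 2 (2 * n.+1)).+1)) (fun s =>
    exists m (D E : nat -> nat -> nat),
    [/\ forall u c, (u <= n)%N -> (c < 3)%N -> mkey m u c = key x u c,
        forall t, t \in [:: (1, 2, 0); (0, 2, 1); (0, 1, 2)]%N ->
          forall u, (1 <= u <= n)%N -> corner_min m n u u t.1.1 t.1.2 t.2 (D t.2 u),
        forall t, t \in triples ->
          forall u, (1 <= u <= n)%N -> D t.1.2 u <> 0%N ->
          corner_min m n u (D t.1.2 u) t.1.1 t.1.2 t.2 (E (pair_code t) u) &
        output s = all_entries (mkey m) D E n]).
Proof.
have [C0 setupP] := setup_spec.
have [C1 sortP] := sort_all_spec R.
have [C2 firstP] := first_sweeps_spec R.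
have [C3 secondP] := second_sweeps_spec R.
have [C4 writeP] := write_entries_spec R.
exists (C0 + C1 + C2 + C3 + C4)%N => n x [kref kinj].
set L := trunc_log 2 (2 * n.+1).
apply: (within_weaken (T := C0 * n.+1 + (C1 * (n.+1 * L.+1) + (C2 * (n.+1 * L.+1) +
  (C3 * (n.+1 * L.+1) + C4 * n.+1))))%N); [|nia|by move=> s'; apply].
apply: within_seq (setupP n x) _ => s1 [K [/andP[nK K2] [s1n s1K] id1 [zero1 s13] key1]].
(* [K] depends on the run through the set-up, [L] on n only. *)
have KL : (K <= L)%N by apply: trunc_log_max.
have budget c : (c * (n.+1 * K.+1) <= c * (n.+1 * L.+1))%N by rewrite !leq_mul2l ltnS KL !orbT.
have keys : distinct_keys (mkey (rmem s1)) n.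
  split=> [u c c3 u1n|u w c c3 u1n w1n uw]; rewrite !key1 //; try lia.
    exact: kref.
  exact: kinj.
have tableI X s s' a : frame (scratch ++ X) s s' -> (9 < a)%N || (a \in [:: 0; 3; vSize])%N ->
    a \notin X -> imem s' a = imem s a.
  move=> fr a9 aX; apply: (frame_imem fr).
  by move: a9; rewrite mem_cat negb_or aX andbT !inE; lia.
apply: within_seq.
  exact: (within_weaken (sortP s1 K n s1n s1K nK zero1 keys) (budget _) (fun _ h => h)).
move=> s2 [fr2 srt2]; have rm2 : rmem s2 = rmem s1 by case: fr2.
rewrite -rm2 in keys srt2 key1.
have I2 a := tableI _ _ _ a fr2.
have s2n : imem s2 0 0 = n by rewrite I2.
have s2K : imem s2 vSize 0 = (2 ^ K)%N by rewrite I2.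
have id2 u : (1 <= u <= n)%N -> imem s2 10 u = u by rewrite I2 //; exact: id1.
have zero2 a k : (19 < a)%N -> imem s2 a k = 0%N.
  by move=> a19; rewrite I2 ?mem_iota; [apply: zero1; lia|lia|lia].
apply: within_seq.
  exact: (within_weaken (firstP s2 K n s2n s2K nK keys srt2 zero2 id2) (budget _) (fun _ h => h)).
move=> s3 [fr3 near3]; have rm3 : rmem s3 = rmem s2 by case: fr3.
rewrite -rm3 in keys srt2 key1 near3.
have I3 a := tableI _ _ _ a fr3.
have s3n : imem s3 0 0 = n by rewrite I3.
have s3K : imem s3 vSize 0 = (2 ^ K)%N by rewrite I3.
have srt3 c : (c < 3)%N -> sorted_by (rmem s3) n c (imem s3 (perm_arr c)) (imem s3 (rank_arr c)).
  by move=> c3; rewrite !I3 ?mem_iota; try lia; exact: srt2.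
have zero3 a k : (29 < a)%N -> imem s3 a k = 0%N.
  by move=> a29; rewrite I3 ?mem_iota; [apply: zero2; lia|lia|lia].
have near_le c u : (c < 3)%N -> (1 <= u <= n)%N -> (imem s3 (near_arr c) u <= n)%N.
  move=> c3 u1n.
  have [t [tin <-]] : exists t : nat * nat * nat,
      t \in [:: (1, 2, 0); (0, 2, 1); (0, 1, 2)]%N /\ t.2 = c.
    by case: c c3 => [|[|[|//]]] _; [exists (1, 2, 0)%N|exists (0, 2, 1)%N|exists (0, 1, 2)%N].
  have [ok _] := near3 t tin u u1n.
  have [->//|/eqP d0] := eqVneq (imem s3 (near_arr t.2) u) 0%N.
  by case: (ok d0) => /andP[].
apply: within_seq.
  exact: (within_weaken (secondP s3 K n s3n s3K nK keys srt3 zero3 near_le) (budget _) (fun _ h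
      => h)).
move=> s4 [fr4 corner4]; have rm4 : rmem s4 = rmem s3 by case: fr4.
rewrite -rm4 in key1 near3 corner4.
have I4 a := tableI _ _ _ a fr4.
have s4n : imem s4 0 0 = n by rewrite I4.
have s43 : imem s4 3 0 = 0%N by rewrite I4 // I3 // I2.
apply: (within_weaken (writeP s4 n s4n s43) (leqnn _)) => s5 out5.
exists (rmem s4), (fun c => imem s4 (near_arr c)), (fun c => imem s4 (corner_arr c)); split=> //.
- move=> t tin u u1n; rewrite I4; [exact: near3|lia|].
  by move: tin; rewrite mem_iota !inE => /or3P[]/eqP ->.
- move=> t tin u u1n; rewrite I4; [exact: corner4|lia|].
  by move: tin; rewrite mem_iota !inE; do 5?[case/orP=> [/eqP -> //|]]; move/eqP ->.
Qed.

End Program.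

(** * The listed entries are the non-zero ones *)

Lemma triplesP (t : nat * nat * nat) : t \in triples ->
  exists p q c : 'I_3, [/\ t = (val p, val q, val c), p != q, c != p & c != q].
Proof.
pose o1 : 'I_3 := Ordinal (isT : 1 < 3)%N; pose o2 : 'I_3 := Ordinal (isT : 2 < 3)%N.
rewrite !inE.
move=> /orP[/eqP ->|/orP[/eqP ->|/orP[/eqP ->|/orP[/eqP ->|/orP[/eqP ->|/eqP ->]]]]].
- by exists ord0, o1, o2.
- by exists ord0, o2, o1.
- by exists o1, ord0, o2.
- by exists o1, o2, ord0.
- by exists o2, ord0, o1.
- by exists o2, o1, ord0.
Qed.

Lemma in_triples (p q c : 'I_3) : p != q -> c != p -> c != q -> (val p, val q, val c) \in triples.
Proof.
by case: p q c => [[|[|[|//]]] hp] [[|[|[|//]]] hq] [[|[|[|//]]] hc].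
Qed.

Lemma third (p q : 'I_3) : p != q -> exists2 c : 'I_3, c != p & c != q.
Proof.
move=> pq; have : (3 - (p + q) < 3)%N.
  by case: p q pq => [[|[|[|//]]] hp] [[|[|[|//]]] hq].
move=> h; exists (Ordinal h); case: p q pq h => [[|[|[|//]]] hp] [[|[|[|//]]] hq] //.
Qed.

Lemma third_unique (p q c c' : 'I_3) : p != q -> c != p -> c != q ->
  c' != p -> c' != q -> c = c'.
Proof.
move=> pq cp cq c'p c'q; apply: val_inj; case: p q c c' pq cp cq c'p c'q =>
  [[|[|[|//]]] hp] [[|[|[|//]]] hq] [[|[|[|//]]] hc] [[|[|[|//]]] hc'] //.
Qed.

Section Correctness.
Variables (R : realType) (n : nat) (x : hv_instance R n).
Hypothesis x_valid : hv_valid x.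
Local Notation r := (refpoint x).
Local Notation Y := (points x).
Local Notation y i c := (points x 0 (coord i c)).

Lemma key_coord (i : 'I_n) (c : 'I_3) : key x i.+1 c = y i c.
Proof.
rewrite /key /read_row; case: insubP => [j _ jE|]; last first.
  by have := ltn_ord (coord i c); rewrite /= => ->.
by congr (points x 0 _); apply: val_inj; rewrite jE.
Qed.

Lemma key_ref (c : 'I_3) : key x 0 c = r 0 c.
Proof. by rewrite /key /read_row; case: insubP => [j _ /val_inj -> //|]; rewrite ltn_ord. Qed.

Lemma Y_lt_ref (i : 'I_n) (c : 'I_3) : Y 0 (coord i c) < r 0 c.
Proof. by have [/(_ i c) + _ _] := x_valid; rewrite mxE. Qed.

Lemma Y_neq (i j : 'I_n) (c : 'I_3) : i != j -> Y 0 (coord i c) != Y 0 (coord j c).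
Proof. by move=> ij; have [_ _ /(_ i j c ij)] := x_valid; rewrite !mxE. Qed.

(** Otherwise [j] would dominate [i]. *)
Lemma nondominated_lt (i j : 'I_n) (p q c : 'I_3) : p != q -> c != p -> c != q ->
  y j p < y i p -> y j q < y i q -> y i c < y j c.
Proof.
move=> pq cp cq jp jq; rewrite lt_neqAle; apply/andP; split.
  by apply: Y_neq; apply: contraTneq jp => ->; rewrite ltxx.
rewrite leNgt; apply/negP => jc; have [_ /(_ j i) nd _] := x_valid; apply: nd => c'.
rewrite !mxE.
have : [|| c' == p, c' == q | c' == c].
  by case: p q c c' pq cp cq {jp jq jc} => [[|[|[|//]]] hp] [[|[|[|//]]] hq] [[|[|[|//]]] hc]
      [[|[|[|//]]] hc'].
by case/or3P => /eqP ->.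
Qed.

Lemma distinct_keys_valid : distinct_keys (key x) n.
Proof.
have ord u : (1 <= u <= n)%N -> exists i : 'I_n, u = i.+1.
  by case: u => // u un; exists (Ordinal un).
split=> [u c c3 /ord[i ->]|u w c c3 /ord[i ->] /ord[j ->] uw].
  by rewrite (key_coord i (Ordinal c3)) (key_ref (Ordinal c3)) Y_lt_ref.
rewrite (key_coord i (Ordinal c3)) (key_coord j (Ordinal c3)); apply/eqP/Y_neq.
by apply/eqP => ij; apply: uw; rewrite ij.
Qed.

Variables (m : nat -> nat -> R) (D E : nat -> nat -> nat).
Local Notation k := (mkey m).
Hypothesis kE : forall u c, (u <= n)%N -> (c < 3)%N -> k u c = key x u c.
Hypothesis D_near : forall t, t \in [:: (1, 2, 0); (0, 2, 1); (0, 1, 2)]%N ->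
  forall u, (1 <= u <= n)%N -> corner_min m n u u t.1.1 t.1.2 t.2 (D t.2 u).
Hypothesis E_corner : forall t, t \in triples ->
  forall u, (1 <= u <= n)%N -> D t.1.2 u <> 0%N ->
  corner_min m n u (D t.1.2 u) t.1.1 t.1.2 t.2 (E (pair_code t) u).

Lemma kY (i : 'I_n) (c : 'I_3) : k i.+1 c = y i c.
Proof. by rewrite kE ?key_coord. Qed.

Lemma k_ref (c : 'I_3) : k 0 c = r 0 c.
Proof. by rewrite kE ?key_ref. Qed.

Lemma corner_minP (i j : 'I_n) (p q c : 'I_3) d :
  corner_min m n i.+1 j.+1 p q c d ->
  (d = 0%N /\ forall l, ~ (y l p < y i p /\ y l q < y j q)) \/
  exists l : 'I_n, [/\ d = l.+1, y l p < y i p, y l q < y j q &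
    forall l', y l' p < y i p -> y l' q < y j q -> y l c <= y l' c].
Proof.
case: d => [|d] [dW dmin].
  left; split=> // l [lp lq]; have := dmin l.+1; rewrite k_ref !kY leNgt Y_lt_ref.
  move=> h; suff: false by []; apply: h => //.
  by split=> //; rewrite /= ltn_ord.
right; have [//|/andP[_ dn]] := dW; rewrite -!/(k _ _).
rewrite -[d]/(val (Ordinal dn)) !kY => dp dq; exists (Ordinal dn); split=> // l lp lq.
have := dmin l.+1; rewrite -[d]/(val (Ordinal dn)) !kY; apply=> //.
by split=> //; rewrite /= ltn_ord.
Qed.

(** The answer 0 has the coordinates of the reference point, which is also the
    default value of the minimum. *)
Lemma corner_end_min (i j : 'I_n) (p q c : 'I_3) d :
  corner_min m n i.+1 j.+1 p q c d -> corner_end r Y i j p q c = k d c.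
Proof.
case/corner_minP => [[-> none]|[l [-> lp lq lmin]]].
  rewrite k_ref /corner_end big_pred0 // => l; rewrite finset.inE.
  by apply/negP => /andP[lp lq]; apply: (none l).
apply/eqP; rewrite kY eq_le; apply/andP; split.
  by apply: bigmin_le_cond; rewrite finset.inE lp lq.
apply: le_bigmin => [|l']; first exact/ltW/Y_lt_ref.
by rewrite finset.inE => /andP[l'p l'q]; exact: lmin.
Qed.

Lemma D_corner (i : 'I_n) (p q c : 'I_3) : p != q -> c != p -> c != q ->
  corner_min m n i.+1 i.+1 p q c (D c i.+1).
Proof.
have i1n : (1 <= i.+1 <= n)%N by rewrite /= ltn_ord.
have D2 p' q' c' : (p', q', c') \in [:: (1, 2, 0); (0, 2, 1); (0, 1, 2)]%N ->
    corner_min m n i.+1 i.+1 q' p' c' (D c' i.+1).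
  by move=> /D_near /(_ _ i1n); apply: best_ext => w _; split=> -[].
by case: p q c => [[|[|[|//]]] hp] [[|[|[|//]]] hq] [[|[|[|//]]] hc] //= _ _ _;
  (exact: (D_near (t := (_, _, _))) || exact: D2).
Qed.

Local Notation hess i p j q := (hessian (calH r) Y (coord i p) (coord j q)).

(** A point that is below [i] in two coordinates is above it in the third one,
    so the edge does not end before it starts. *)
Lemma hessian_diagonal (i : 'I_n) (p q c : 'I_3) : p != q -> c != p -> c != q ->
  hess i p i q = k (D c i.+1) c - k i.+1 c /\ hess i p i q != 0.
Proof.
move=> pq cp cq.
have gt0 : 0 < k (D c i.+1) c - y i c.
  rewrite subr_gt0; case: (corner_minP (D_corner i pq cp cq)) => [[-> _]|[l [-> lp lq _]]].
    by rewrite k_ref Y_lt_ref.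
  by rewrite kY; apply: nondominated_lt lp lq.
rewrite (hessian_formula Y_lt_ref Y_neq _ _ pq cp cq) eqxx.
rewrite (corner_end_min (D_corner i pq cp cq)) kY.
by rewrite max_r ?ltW // gt_eqF.
Qed.

(** The edge starts at the height of [i].  A point that ended it below that
    height would be below [i] in [p] and [c] and nearer to [i] in [q] than
    [j]. *)
Lemma hessian_neighbour (i j : 'I_n) (p q c : 'I_3) : p != q -> c != p -> c != q ->
  D q i.+1 = j.+1 ->
  let v := k i.+1 c - k (E (pair_code (val p, val q, val c)) i.+1) c in
  [/\ hess i p j q = v, hess j q i p = v, v != 0, i != j & y j c < y i c].
Proof.
move=> pq cp cq Dq v.
have i1n : (1 <= i.+1 <= n)%N by rewrite /= ltn_ord.
have pc : p != c by rewrite eq_sym.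
have qc : q != c by rewrite eq_sym.
have qp : q != p by rewrite eq_sym.
have := corner_minP (D_corner i pc qp qc); rewrite Dq.
case=> [[]//|[l [[/val_inj <-] jp jc jmin]]].
have iq : y i q < y j q by apply: nondominated_lt jp jc.
have := E_corner (in_triples pq cp cq) i1n; rewrite [_.1.2]/= Dq => /(_ (fun e =>
    match e with end)) Emin.
have v0 : v < 0.
  rewrite /v kY subr_lt0; case: (corner_minP Emin) => [[-> _]|[l' [-> lp lq _]]].
    by rewrite k_ref Y_lt_ref.
  rewrite kY lt_neqAle; apply/andP; split.
    by apply: Y_neq; apply: contraTneq lp => <-; rewrite ltxx.
  rewrite leNgt; apply/negP => lc; have := jmin l' lp lc.
  by rewrite leNgt lq.
have Egt : y i c < k (E (pair_code (val p, val q, val c)) i.+1) c.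
  by move: v0; rewrite /v kY subr_lt0.
have ij : i != j by apply: contraTneq jp => <-; rewrite ltxx.
have maxE : Num.max (Y 0 (coord i c)) (Y 0 (coord j c)) = y i c by apply/max_idPl/ltW.
split=> //; last by rewrite lt_eqF.
- rewrite (hessian_formula Y_lt_ref Y_neq _ _ pq cp cq) (negbTE ij).
  rewrite jp iq maxE (corner_end_min Emin).
  by rewrite max_r ?subr_ge0 ?ltW // opprB /v kY.
- rewrite (hessian_formula Y_lt_ref Y_neq _ _ qp cq cp) eq_sym (negbTE ij).
  rewrite jp iq [Num.max (y j c) _]maxC maxE.
  have -> : corner_end r Y j i q p c = corner_end r Y i j p q c.
    by apply: eq_bigl => l'; rewrite !finset.inE andbC.
  rewrite (corner_end_min Emin).
  by rewrite max_r ?subr_ge0 ?ltW // opprB /v kY.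
Qed.

(** If [j] is below [i] in [c] but is not its nearest point in [q], then the
    nearest point lies in the corner set and below [i] in [c], so it ends the
    edge before the edge starts.  Otherwise [i] is below [j] in [c], and the
    roles are exchanged. *)
Lemma hessian_offdiagonal_nz (i j : 'I_n) (p q c : 'I_3) : p != q -> c != p -> c != q ->
  i != j -> hess i p j q != 0 -> D q i.+1 = j.+1 \/ D p j.+1 = i.+1.
Proof.
move=> pq cp cq ij.
have pc : p != c by rewrite eq_sym.
have qc : q != c by rewrite eq_sym.
have qp : q != p by rewrite eq_sym.
rewrite (hessian_formula Y_lt_ref Y_neq _ _ pq cp cq) (negbTE ij).
case: ifP; last by rewrite eqxx.
move=> /andP[jp iq]; rewrite oppr_eq0.
case: (leP (corner_end r Y i j p q c - Num.max (y i c) (y j c)) 0) => [le0|gt0 _].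
  by rewrite eqxx.
move: gt0; rewrite subr_gt0 gt_max => /andP[iM jM].
have Mle l : y l p < y i p -> y l q < y j q -> corner_end r Y i j p q c <= y l c.
  by move=> lp lq; apply: bigmin_le_cond; rewrite finset.inE lp lq.
(* The lower one of [i] and [j] is the nearest point of the other one: a nearer
   point would end the edge before its start. *)
have [jc|ic] : y j c < y i c \/ y i c < y j c.
  by have := Y_neq c ij; case: (ltgtP (y i c) (y j c)) => // *; [right|left].
- left; case: (corner_minP (D_corner i pc qp qc)) => [[_ none]|[l [-> lp lc lmin]]].
    by case: (none j).
  congr S; apply/eqP; apply/negPn/negP => lj.
  have lq : y l q < y j q.
    by rewrite lt_neqAle lmin // andbT; exact: Y_neq.
  by have := Mle l lp lq; rewrite leNgt (lt_trans lc iM).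
- right; case: (corner_minP (D_corner j qc pq pc)) => [[_ none]|[l [-> lq lc lmin]]].
    by case: (none i).
  congr S; apply/eqP; apply/negPn/negP => li.
  have lp : y l p < y i p.
    by rewrite lt_neqAle lmin // andbT; exact: Y_neq.
  by have := Mle l lp lq; rewrite leNgt (lt_trans lc jM).
Qed.

Lemma row_coord (i : 'I_n) (p : 'I_3) : row i.+1 p = coord i p.
Proof. by rewrite /row /=; lia. Qed.

(** An inverse of the enumeration of the items: an entry can only have been
    written on behalf of the point that is higher in the third coordinate.
    Hence no entry is written twice. *)
Definition item_of (i j : 'I_n) (p q c : 'I_3) : nat * (nat * (nat * nat * nat)) :=
  if i == j then (i.+1, (0%N, (val p, val q, val c)))
  else if y j c < y i c then (i.+1, (1%N, (val p, val q, val c)))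
  else (j.+1, (2%N, (val q, val p, val c))).

Definition items : seq (nat * (nat * (nat * nat * nat))) :=
  [seq (u, z) | u <- iota 1 n, z <- kinds].

Lemma listed_item z : z \in items -> listed D z -> exists i j p q c,
  [/\ p != q, c != p & c != q] /\
  [/\ z = item_of i j p q c, hess i p j q != 0 &
      entry k D E z = (val (coord i p), val (coord j q), hess i p j q)].
Proof.
case/allpairsP => -[u [kind t]] /= [uin /allpairsP[[kind' t'] /= [kin tin [-> ->]]] ->].
move: uin; rewrite mem_iota; case: u => // u un.
have {un}un : (u < n)%N by lia.
rewrite -[u]/(val (Ordinal un)); move: (Ordinal un) => i {u un}.
have [p [q [c [-> pq cp cq]]]] := triplesP tin.
move: kin; rewrite !inE; case: kind' => [|kind'] kin.
  move=> _; have [hE hnz] := hessian_diagonal i pq cp cq.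
  exists i, i, p, q, c; split=> //; split=> //; first by rewrite /item_of eqxx.
  by rewrite /entry -hE !row_coord.
move=> Dq0.
have [j Dq] : exists j : 'I_n, D q i.+1 = j.+1.
  have pc : p != c by rewrite eq_sym.
  have qc : q != c by rewrite eq_sym.
  have qp : q != p by rewrite eq_sym.
  have [[D0 _]|[j [-> _ _ _]]] := corner_minP (D_corner i pc qp qc); last by exists j.
  by move: Dq0; case: (kind') => [|?]; rewrite /= D0.
have /= [h1 h2 vnz ij ji] := hessian_neighbour pq cp cq Dq.
case: kind' kin {Dq0} => [|[|//]] _.
  exists i, j, p, q, c; split=> //; split=> //; rewrite ?h1 //.
    by rewrite /item_of (negbTE ij) ji.
  by rewrite /entry Dq !row_coord.
exists j, i, q, p, c; split; first by rewrite eq_sym.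
split=> //; rewrite ?h2 //.
  by rewrite /item_of eq_sym (negbTE ij) ltNge ltW.
by rewrite Dq !row_coord.
Qed.

Lemma item_of_listed (i j : 'I_n) (p q c : 'I_3) : p != q -> c != p -> c != q ->
  hess i p j q != 0 -> let z := item_of i j p q c in
  [/\ z \in items, listed D z & entry k D E z = (val (coord i p), val (coord j q), hess i p j q)].
Proof.
move=> pq cp cq hnz; rewrite /= /item_of.
have uin (l : 'I_n) : l.+1 \in iota 1 n by rewrite mem_iota /= add1n ltnS.
have tin kind p' q' : (kind < 3)%N -> p' != q' -> c != p' -> c != q' ->
    (kind, (val p', val q', val c)) \in kinds.
  by move=> k3 *; apply: allpairs_f; [rewrite mem_iota|exact: in_triples].
have qp : q != p by rewrite eq_sym.
case: (eqVneq i j) hnz => [<- _|ij hnz].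
  split=> //; first by apply: allpairs_f => //; exact: tin.
  by rewrite /entry -(hessian_diagonal i pq cp cq).1 !row_coord.
have [Dq|Dp] := hessian_offdiagonal_nz pq cp cq ij hnz.
  have /= [h1 h2 vnz _ ji] := hessian_neighbour pq cp cq Dq; rewrite ji.
  split; first by apply: allpairs_f => //; exact: tin.
    by rewrite /= Dq.
  by rewrite /= Dq !row_coord h1.
have /= [h1 h2 vnz _ ji] := hessian_neighbour qp cq cp Dp; rewrite ltNge (ltW ji) /=.
split; first by apply: allpairs_f => //; exact: tin.
  by rewrite Dp.
by rewrite Dp !row_coord h2.
Qed.

Lemma all_entries_correct s : output s = all_entries k D E n -> hessian_answer x s.
Proof.
move=> out; rewrite /hessian_answer out /all_entries -/items; split.
  rewrite map_inj_in_uniq => [|z1 z2]; last first.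
    rewrite !mem_filter => /andP[l1 /listed_item/(_ l1)].
    move=> [i1 [j1 [p1 [q1 [c1 [[pq1 cp1 cq1] [z1E _ ->]]]]]]].
    move=> /andP[l2 /listed_item/(_ l2)].
    move=> [i2 [j2 [p2 [q2 [c2 [[pq2 cp2 cq2] [z2E _ ->]]]]]]].
    move=> [e1 e2 _].
    have /eqP := val_inj (e1 : val (coord i1 p1) = val (coord i2 p2)).
    have /eqP := val_inj (e2 : val (coord j1 q1) = val (coord j2 q2)).
    rewrite !coord_inj => /andP[/eqP j12 /eqP q12] /andP[/eqP i12 /eqP p12]; subst i2 p2 j2 q2.
    rewrite z1E z2E; congr item_of.
    exact: third_unique pq1 cp1 cq1 cp2 cq2.
  apply: filter_uniq; apply: allpairs_uniq; [exact: iota_uniq| |].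
    by vm_compute.
  by move=> [u1 z1] [u2 z2].
move=> a b v; split.
  case/mapP => z; rewrite mem_filter => /andP[lz /listed_item/(_ lz)].
  move=> [i [j [p [q [c [_ [_ hnz ->]]]]]]] [-> -> ->].
  by exists (coord i p), (coord j q).
move=> [a' [b' [-> -> -> ]]].
have [i [p ->]] := coord_surj a'; have [j [q ->]] := coord_surj b'.
have [->|pq hnz] := eqVneq p q.
  by rewrite (hessian_same_coordinate Y_lt_ref Y_neq) eqxx.
have [c cp cq] := third pq.
have [zin lz <-] := item_of_listed pq cp cq hnz.
by apply: map_f; rewrite mem_filter lz.
Qed.

End Correctness.

(** * The lower bound *)

Section Traces.
Variable R : realType.
Implicit Types (s : state R).

(** The outcomes of all comparisons of reals made in evaluating [b]. *)
Fixpoint comparisons s (b : bexp) : seq bool :=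
  match b with
  | BLtI _ _ => [::]
  | BLtR _ _ => [:: beval s b]
  | BNot b1 => comparisons s b1
  | BAnd b1 b2 => comparisons s b1 ++ comparisons s b2
  end.

Inductive traced : cmd -> state R -> state R -> seq bool -> Prop :=
| TSkip s : traced Skip s s [::]
| TIStore s a k e : traced (IStore a k e) s
    (State (update (imem s) a (ieval s k) (ieval s e)) (rmem s)) [::]
| TRStore s a k e : traced (RStore a k e) s
    (State (imem s) (update (rmem s) a (ieval s k) (reval s e))) [::]
| TSeq c1 c2 s1 s2 s3 w1 w2 : traced c1 s1 s2 w1 -> traced c2 s2 s3 w2 ->
    traced (Seq c1 c2) s1 s3 (w1 ++ w2)
| TIf b c1 c2 s s' w : traced (if beval s b then c1 else c2) s s' w ->
    traced (If b c1 c2) s s' (comparisons s b ++ w)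
| TWhileFalse b c s : ~~ beval s b -> traced (While b c) s s (comparisons s b)
| TWhileTrue b c s1 s2 s3 w1 w2 : beval s1 b -> traced c s1 s2 w1 ->
    traced (While b c) s2 s3 w2 ->
    traced (While b c) s1 s3 (comparisons s1 b ++ w1 ++ w2).

Lemma size_comparisons m s b : (size (comparisons s b) <= bcost m b)%N.
Proof. by elim: b => //= [b|b1 ih1 b2 ih2]; rewrite ?size_cat; lia. Qed.

Lemma exec_traced m c s s' t : exec m c s s' t ->
  exists2 w, traced c s s' w & (size w <= t)%N.
Proof.
elim=> {c s s' t}.
- by move=> s; exists [::] => //; constructor.
- by move=> s a k e; exists [::] => //; constructor.
- by move=> s a k e; exists [::] => //; constructor.
- move=> c1 c2 s1 s2 s3 t1 t2 _ [w1 tr1 le1] _ [w2 tr2 le2].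
  by exists (w1 ++ w2); [apply: TSeq tr1 tr2|rewrite size_cat; lia].
- move=> b c1 c2 s s' t _ [w tr le]; exists (comparisons s b ++ w); first by constructor.
  by rewrite size_cat; have := size_comparisons m s b; lia.
- by move=> b c s nb; exists (comparisons s b); [constructor|exact: size_comparisons].
- move=> b c s1 s2 s3 t1 t2 sb _ [w1 tr1 le1] _ [w2 tr2 le2].
  exists (comparisons s1 b ++ w1 ++ w2); first exact: TWhileTrue tr1 tr2.
  by rewrite !size_cat; have := size_comparisons m s1 b; lia.
Qed.

Lemma ieval_imem s1 s2 e : imem s1 = imem s2 -> ieval s1 e = ieval s2 e.
Proof. by move=> im; elim: e => //= [a e ->|e1 -> e2 ->|e1 -> e2 ->|e ->]; rewrite ?im. Qed.

Lemma comparisons_beval s1 s2 b (w1 w2 : seq bool) : imem s1 = imem s2 ->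
  comparisons s1 b ++ w1 = comparisons s2 b ++ w2 -> beval s1 b = beval s2 b /\ w1 = w2.
Proof.
move=> im; elim: b w1 w2 => /= [e1 e2|e1 e2|b ih|b1 ih1 b2 ih2] w1 w2.
- by rewrite !(ieval_imem _ im).
- by case=> -> ->.
- by move=> /ih[-> ->].
- by rewrite -!catA => /ih1[-> /ih2[-> ->]].
Qed.

(** The outcomes followed by arbitrary words, because the traces of two runs
    need not have the same length before they are known to agree. *)
Lemma traced_imem c s1 s1' s2 s2' (w1 w2 v1 v2 : seq bool) :
  traced c s1 s1' w1 -> traced c s2 s2' w2 -> imem s1 = imem s2 ->
  w1 ++ v1 = w2 ++ v2 -> imem s1' = imem s2' /\ v1 = v2.
Proof.
move=> tr1; elim: tr1 s2 s2' w2 v1 v2 => {c s1 s1' w1}.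
- by move=> s s2 s2' w2 v1 v2 tr2; inversion tr2; subst.
- move=> s a k e s2 s2' w2 v1 v2 tr2 im; inversion tr2; subst => /= ->.
  by rewrite im !(ieval_imem _ im).
- by move=> s a k e s2 s2' w2 v1 v2 tr2 im; inversion tr2; subst => /= ->.
- move=> c1 c2 s1 s2 s3 w1 w2 _ ih1 _ ih2 s4 s5 w v1 v2 tr im; inversion tr; subst.
  rewrite -!catA => e.
  have [im2 e2] := ih1 _ _ _ _ _ ltac:(eassumption) im e.
  exact: ih2 ltac:(eassumption) im2 e2.
- move=> b c1 c2 s s' w _ ih s4 s5 w5 v1 v2 tr im; inversion tr; subst.
  rewrite -!catA => /(comparisons_beval im)[be e].
  by apply: (ih _ _ _ _ _ _ im e); rewrite be; eassumption.
- move=> b c s nb s4 s5 w5 v1 v2 tr im; inversion tr; subst.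
    by move=> /(comparisons_beval im)[_ ->].
  rewrite -!catA => /(comparisons_beval im)[be e].
  by rewrite be in nb; match goal with h : is_true (beval _ _) |- _ => by rewrite h in nb end.
- move=> b c s1 s2 s3 w1 w2 sb _ ih1 _ ih2 s4 s5 w v1 v2 tr im; inversion tr; subst.
    rewrite -!catA => /(comparisons_beval im)[be e].
    by rewrite be in sb; match goal with h : is_true (~~ beval _ _) |- _ => by rewrite sb in h end.
  rewrite -!catA => /(comparisons_beval im)[_ e].
  have [im2 e2] := ih1 _ _ _ _ _ ltac:(eassumption) im e.
  exact: ih2 ltac:(eassumption) im2 e2.
Qed.

(** Padding the traces to length [T] keeps them distinguishable, since no trace
    is a proper prefix of another one. *)
Lemma card_le_exp_time m c (I : finType) (s s' : I -> state R) (t : I -> nat) (T : nat) :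
  (forall i j, imem (s i) = imem (s j)) -> (forall i, exec m c (s i) (s' i) (t i)) ->
  (forall i, (t i <= T)%N) -> injective (fun i => imem (s' i)) -> (#|I| <= 2 ^ T)%N.
Proof.
move=> im ex tT inj.
have tr i : exists w, traced c (s i) (s' i) w /\ (size w <= T)%N.
  by have [w trw le] := exec_traced (ex i); exists w; split=> //; exact: leq_trans (tT i).
have [w wP] := choice tr.
have size_pad i : size (w i ++ nseq (T - size (w i)) false) == T.
  by rewrite size_cat size_nseq subnKC //; case: (wP i).
rewrite -card_bool -card_tuple.
apply: (leq_card (fun i => Tuple (size_pad i))) => i j /(congr1 val) /= e; apply: inj.
have [tri _] := wP i; have [trj _] := wP j.
by have [] := traced_imem tri trj (im i j) e.
Qed.

End Traces.

(** Pair the factors i + 1 and n - i of two copies of the factorial. *)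
Lemma expn_leq_fact2 n : (n ^ n <= n`! ^ 2)%N.
Proof.
have factE : n`! = (\prod_(i < n) i.+1)%N by rewrite fact_prod big_add1 big_mkord.
have revE : n`! = (\prod_(i < n) (n - i))%N.
  rewrite factE (reindex_inj rev_ord_inj) /=; apply: eq_bigr => i _.
  by have := ltn_ord i; lia.
rewrite expnS expn1 {1}factE revE -big_split /= -[X in (X ^ _)%N]card_ord -[X in (_ ^ X)%N]card_ord.
rewrite -prod_nat_const; apply: leq_prod => i _.
by rewrite card_ord; have := ltn_ord i; nia.
Qed.

Section Chains.
Variables (R : realType) (n : nat).
Implicit Types (sigma : {perm 'I_n}).

Lemma point_of_proof (a : 'I_(3 * n)) : (a %/ 3 < n)%N.
Proof. by have := ltn_ord a; lia. Qed.

(** The point with position z in the order [sigma] is (z, - z, z): the first two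
    coordinates rule out domination, and the third one makes each point the
    nearest one to its successor. *)
Definition chain_points sigma : 'rV[R]_(3 * n) :=
  \row_a (let z : R := (sigma (Ordinal (point_of_proof a)))%:R in
          if (a %% 3 == 1)%N then - z else z).

Definition chain_ref : 'rV[R]_3 := \row_c (if val c == 1%N then 1 else n%:R).

Definition chain sigma : hv_instance R n := HVInstance chain_ref (chain_points sigma).

Lemma chain_coord sigma (i : 'I_n) (c : 'I_3) : chain_points sigma 0 (coord i c) =
  if val c == 1%N then - (sigma i)%:R else (sigma i)%:R.
Proof.
rewrite mxE; have -> : Ordinal (point_of_proof (coord i c)) = i.
  by apply: val_inj => /=; have := ltn_ord c; lia.
by have -> : (coord i c %% 3 = val c)%N by rewrite /=; have := ltn_ord c; lia.
Qed.

Lemma chain_lt_ref sigma i c : chain_points sigma 0 (coord i c) < chain_ref 0 c.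
Proof.
rewrite chain_coord [chain_ref _ _]mxE; case: ifP => _; last by rewrite ltr_nat.
by apply: le_lt_trans ltr01; rewrite oppr_le0.
Qed.

Lemma chain_neq sigma i j c : i != j ->
  chain_points sigma 0 (coord i c) != chain_points sigma 0 (coord j c).
Proof.
move=> ij; rewrite !chain_coord; case: ifP => _; rewrite ?eqr_opp eqr_nat;
  by apply: contra ij => /eqP/val_inj/perm_inj ->.
Qed.

Lemma chain_valid sigma : hv_valid (chain sigma).
Proof.
have ptE k c : ith_point (points (chain sigma)) k 0 c = chain_points sigma 0 (coord k c).
  by rewrite mxE.
split=> [i c|i j dom|i j c ij]; rewrite ?ptE; first exact: chain_lt_ref.
  have := dom ord0; have := dom (Ordinal (isT : 1 < 3)%N).
  rewrite !ptE !chain_coord /= ltrN2 => lt1 lt2.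
  by have := lt_trans lt1 lt2; rewrite ltxx.
exact: chain_neq.
Qed.

(** An edge from [i] in the first coordinate to an earlier [j] in the second one
    is cut off, below its start, by the points between them. *)
Lemma chain_hessian sigma (i j : 'I_n) (p q : 'I_3) : val p = 0%N -> val q = 1%N -> i != j ->
  (hessian (calH chain_ref) (chain_points sigma) (coord i p) (coord j q) != 0) =
  (nat_of_ord (sigma i) == (sigma j).+1).
Proof.
move=> p0 q1 ij; pose c : 'I_3 := Ordinal (isT : 2 < 3)%N.
have pq : p != q by rewrite -val_eqE /= p0 q1.
have cp : c != p by rewrite -val_eqE /= p0.
have cq : c != q by rewrite -val_eqE /= q1.
rewrite (hessian_formula (chain_lt_ref sigma) (@chain_neq sigma) _ _ pq cp cq) (negbTE ij).
rewrite !chain_coord p0 q1 /= ltrN2 ltr_nat andbb.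
case: ltnP => [ji|]; last by rewrite eqxx => ?; apply/esym/negbTE; lia.
rewrite oppr_eq0 [Num.max (sigma i)%:R _]max_l ?ler_nat ?(ltnW ji) //.
have [sij|sij] := eqVneq (nat_of_ord (sigma i)) (sigma j).+1.
    have -> : corner_end chain_ref (chain_points sigma) i j p q c = n%:R.
    rewrite /corner_end big_pred0 ?mxE // => l; rewrite finset.inE !chain_coord p0 q1 /=.
    by rewrite ltrN2 !ltr_nat sij; lia.
  by rewrite max_r ?subr_ge0 ?ler_nat ?subr_eq0 ?eqr_nat; have := ltn_ord (sigma i); lia.
have lt_n : ((sigma j).+1 < n)%N by have := ltn_ord (sigma i); lia.
pose l := (sigma^-1)%g (Ordinal lt_n).
have sl : sigma l = Ordinal lt_n by rewrite permKV.
rewrite max_l ?eqxx // subr_le0; apply: (@bigmin_inf _ _ _ _ l).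
  by rewrite finset.inE !chain_coord p0 q1 sl /= ltrN2 !ltr_nat; lia.
by rewrite chain_coord sl /= ler_nat; lia.
Qed.

(** By induction on the position: a successor goes to a successor. *)
Lemma chain_order_inj (sigma tau : {perm 'I_n}) :
  (forall i j, nat_of_ord (sigma i) == (sigma j).+1 -> nat_of_ord (tau i) == (tau j).+1) ->
  forall i, (sigma i <= tau i)%N.
Proof.
move=> st i; move: {2}(nat_of_ord (sigma i)) (erefl (nat_of_ord (sigma i))) => v;
    elim: v i => [|v ih] i iv.
  by rewrite iv.
have lt_n : (v < n)%N by have := ltn_ord (sigma i); lia.
pose j := (sigma^-1)%g (Ordinal lt_n).
have sj : nat_of_ord (sigma j) = v by rewrite permKV.
have := st i j; rewrite iv sj eqxx => /(_ isT)/eqP ->.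
by have := ih j sj; rewrite sj.
Qed.

Lemma chain_answer_inj (sigma tau : {perm 'I_n}) s s' : hessian_answer (chain sigma) s ->
  hessian_answer (chain tau) s' -> imem s = imem s' -> sigma = tau.
Proof.
pose p : 'I_3 := ord0; pose q : 'I_3 := Ordinal (isT : 1 < 3)%N.
have nz (rho : {perm 'I_n}) s1 (i j : 'I_n) : hessian_answer (chain rho) s1 -> i != j ->
    (nat_of_ord (rho i) == (rho j).+1) <->
    exists v, (val (coord i p), val (coord j q), v) \in output s1.
  move=> [_ ans] ij; rewrite -(@chain_hessian rho i j p q) //; split=> [hnz|[v /ans]].
    eexists; apply/ans; exists (coord i p), (coord j q); split; by [|exact: hnz].
  by case=> a [b [/val_inj <- /val_inj <- ->]].
have out (s1 s2 : state R) a b : imem s1 = imem s2 ->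
    (exists v, (a, b, v) \in output s1) -> exists v, (a, b, v) \in output s2.
  move=> im [v /mapP[k kin [-> -> _]]]; exists (rmem s2 2 k).
  by apply/mapP; exists k; rewrite -?im.
have sub (rho pi : {perm 'I_n}) s1 s2 : hessian_answer (chain rho) s1 ->
    hessian_answer (chain pi) s2 -> imem s1 = imem s2 -> forall i, (rho i <= pi i)%N.
  move=> a1 a2 im; apply: chain_order_inj => i j rij.
  have ij : i != j by apply: contraTneq rij => ->; lia.
  have [h1 _] := nz _ _ _ _ a1 ij; have [_ h2] := nz _ _ _ _ a2 ij.
  exact: (h2 (out _ _ _ _ im (h1 rij))).
move=> a1 a2 im; apply/permP => i; apply: val_inj; apply/eqP; rewrite eqn_leq.
by rewrite (sub _ _ _ _ a1 a2) // (sub _ _ _ _ a2 a1).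
Qed.

End Chains.

Lemma hessian_lower_bound (R : realType) m P : solves m P (hessian_problem R) ->
  worst_time_Omega m P (hessian_problem R) (fun n : nat => n%:R * ln (n%:R : R)).
Proof.
move=> sol; exists 2^-1, 1%N; split=> // n n0.
have run (sigma : {perm 'I_n}) : exists st : state R * nat,
    exec m P (hv_encode (chain R sigma)) st.1 st.2 /\ hessian_answer (chain R sigma) st.1.
  by have [s [t [ex ans]]] := sol n (chain R sigma) (chain_valid R sigma); exists (s, t).
have [st stP] := choice run.
case: (@arg_maxnP _ (1%g : {perm 'I_n}) xpredT (fun sigma => (st sigma).2)) => // sigma _ smax.
exists (chain R sigma); split; first exact: chain_valid.
exists (st sigma).2; split; first by exists (st sigma).1; case: (stP sigma).
have le2 : (n`! <= 2 ^ (st sigma).2)%N.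
  rewrite -card_Sn; apply: (card_le_exp_time (m := m) (c := P) (s := fun rho =>
      hv_encode (chain R rho))
    (s' := fun rho => (st rho).1) (t := fun rho => (st rho).2)) => [//|rho|rho|rho pi e].
  - by case: (stP rho).
  - exact: smax.
  - case: (stP rho) (stP pi) => _ a1 [_ a2].
    exact: chain_answer_inj a1 a2 e.
set t := (st sigma).2 in le2 *.
have nR : 0 < n%:R :> R by rewrite ltr0n.
rewrite ler_pdivrMl //.
have -> : n%:R * ln n%:R = ln ((n ^ n)%:R : R) by rewrite natrX lnXn // mulr_natl.
have le3 : (n ^ n <= 2 ^ (2 * t))%N.
  by rewrite mulnC expnM (leq_trans (expn_leq_fact2 n)) // leq_exp2r.
have ln2 : ln (2 : R) <= 1.
  by have := @le_ln1Dx R 1; rewrite -natr1; apply.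
apply: (@le_trans _ _ (ln ((2 ^ (2 * t))%:R : R))).
  by rewrite ler_ln ?posrE ?ltr0n ?expn_gt0 ?n0 // ler_nat.
rewrite natrX lnXn // -[ln 2 *+ _]mulr_natl natrM.
by rewrite -[X in _ <= X]mulr1 ler_wpM2l // mulr_ge0.
Qed.

(** * Upper bound and conclusion *)

Lemma hessian_program_solves (R : realType) : exists C : nat,
  forall m n (x : hv_instance R n), hv_valid x -> exists s t,
    [/\ exec m hessian_program (hv_encode x) s t, hessian_answer x s &
        (t <= C * (n.+1 * (trunc_log 2 (2 * n.+1)).+1))%N].
Proof.
have [C spec] := hessian_program_spec R; exists C => m n x x_valid.
have [s [t [ex le [k [D [E [kE D_near E_corner out]]]]]]] := spec n x (distinct_keys_valid x_valid).
have [t' le' ex'] := exec_le_AllOps m ex.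
exists s, t'; split=> //; last exact: leq_trans le.
exact (all_entries_correct x_valid kE D_near E_corner out).
Qed.

(** Uses 2 (n + 1) <= n ^ 3, which holds from n = 2 on. *)
Lemma trunc_log_le_ln (R : realType) (n : nat) : (1 < n)%N ->
  (n.+1 * (trunc_log 2 (2 * n.+1)).+1)%:R <= 8 / ln 2 * (n%:R * ln n%:R) :> R.
Proof.
move=> n1; set L := trunc_log 2 _.
have ln2 : 0 < ln 2 :> R by rewrite ln_gt0 // ltr1n.
have nR : 0 < n%:R :> R by rewrite ltr0n; lia.
have leL : (2 ^ L.+1 <= n ^ 4)%N.
  have := @trunc_logP 2 (2 * n.+1) isT isT; rewrite -/L expnS => le.
  have : (2 * n.+1 <= n ^ 3)%N by rewrite !expnS expn0; nia.
  by rewrite [(n ^ 4)%N]expnS; nia.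
have lnL : L.+1%:R * ln 2 <= 4 * ln n%:R :> R.
  rewrite !mulr_natl -!lnXn // -!natrX ler_ln ?posrE ?ltr0n ?expn_gt0; last 2 first.
  - by [].
  - by lia.
  by rewrite ler_nat.
have le_n : n.+1%:R <= 2 * n%:R :> R by rewrite -natrM ler_nat; lia.
have le_L : L.+1%:R <= 4 * ln n%:R / ln 2 :> R by rewrite ler_pdivlMr.
have -> : 8 / ln 2 * (n%:R * ln n%:R) = 2 * n%:R * (4 * ln n%:R / ln 2) :> R by ring.
by rewrite natrM ler_pM.
Qed.

Theorem theorem2 (R : realType) (m : cost_measure) :
  complexity_Theta m (hessian_problem R) (fun n : nat => n%:R * ln (n%:R : R)).
Proof.
split; last exact: hessian_lower_bound.
have [C spec] := hessian_program_solves R.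
exists hessian_program; split.
  by move=> n x x_valid; have [s [t [ex ans _]]] := spec m n x x_valid; exists s, t.
have ln2 : 0 < ln 2 :> R by rewrite ln_gt0 // ltr1n.
exists (C.+1%:R * (8 / ln 2)), 2%N; split.
  by rewrite mulr_gt0 ?ltr0n // divr_gt0.
move=> n n2 x x_valid t [s ex].
have [s' [t' [ex' _ le]]] := spec m n x x_valid.
have [_ ->] := exec_deterministic ex ex'.
apply: (@le_trans _ _ (C.+1 * (n.+1 * (trunc_log 2 (2 * n.+1)).+1))%N%:R).
  by rewrite ler_nat (leq_trans le) // leq_mul2r leqnSn orbT.
by rewrite natrM -mulrA ler_wpM2l // trunc_log_le_ln.
Qed.
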